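(* Each of the following families of ordered hypergraphs (the underlying hypergraphs of the named families of hypergraph polytopes) is a contextual family: (a) simplices; (b) cubes; (c) associahedra; (d) permutahedra; (e) operahedra; (f) contextual graph-associahedra; (g) contextual nestohedra.
   Context: **Hypergraphs.** A hypergraph $\mathbb{H}$ consists of a finite set $H$ of vertices and a set $\mathbb{H}\subseteq\mathcal{P}(H)\setminus\{\emptyset\}$ of hyperedges with $\bigcup\mathbb{H}=H$; it is always assumed atomic, i.e. $\{x\}\in\mathbb{H}$ for all $x\in H$. It is ordered if $H$ carries a total order (inherited by restrictions). For $X\subseteq H$ put $\mathbb{H}_X=\{Z\in\mathbb{H}\mid Z\subseteq X\}$ and $\mathbb{H}\setminus X=\mathbb{H}_{H\setminus X}$. $\mathbb{H}$ is connected if $H\neq\emptyset$ and there is no partition $H=X_1\sqcup X_2$ into non-empty sets with $\mathbb{H}=\mathbb{H}_{X_1}\cup\mathbb{H}_{X_2}$. A non-empty $X\subseteq H$ is connected if $\mathbb{H}_X$ is. Every hypergraph decomposes uniquely into connected components. $\mathrm{Sat}(\mathbb{H})$ is the set of connected subsets of $H$. The reconnected restriction is $\mathbb{H}_{\cap X}=\{Z\cap X\mid Z\in\mathrm{Sat}(\mathbb{H}),Z\cap X\neq\emptyset\}$, a hypergraph on $X$. Hypergraphs on the same vertex set with the same saturation (hence the same polytope) are identified when testing membership in a family. A connected hypergraph has dimension $|H|-1$; $\mathcal{H}(n)$ is the set of $n$-dimensional members of a family $\mathcal{H}$. **Contextual hypergraph.** A connected hypergraph $\mathbb{H}$ is contextual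 if for all connected $Y\subseteq H$ with $|Y|\ge3$ and all 3-element subsets $X\subseteq Y$ one has $\mathbb{H}_{\cap X}=(\mathbb{H}_Y)_{\cap X}$ (equivalently: for all distinct $x,y,z\in Y$, $y$ and $z$ lie in the same connected component of $\mathbb{H}_Y\setminus\{x\}$ iff they lie in the same connected component of $\mathbb{H}\setminus\{x\}$). **Contextual family.** A family $\mathcal{H}$ of ordered hypergraphs is contextual if: (1) every $\mathbb{H}\in\mathcal{H}$ is contextual; (2) for every $\mathbb{H}\in\mathcal{H}$ and $X\subseteq H$, all connected components of $\mathbb{H}\setminus X$ are in $\mathcal{H}$; (3) $\{\mathbb{H}_{\cap X}\mid \mathbb{H}\in\mathcal{H},\ X\subseteq H,\ |X|=3\}\subseteq\mathcal{H}(2)$. **The families.** Throughout, vertex sets are arbitrary non-empty finite totally ordered sets $x_1<\cdots<x_{n+1}$, $n\ge 0$. - Simplices: hyperedges are all singletons and the whole set $\{x_1,\dots,x_{n+1}\}$. - Cubes: hyperedges are all singletons and all initial segments $\{x_1,\dots,x_i\}$, $1\le i\le n+1$. - Associahedra: hyperedges are all singletons and $\{x_i,x_{i+1}\}$, $1\le i\le n$ (linear graph, in the given order). - Permutahedra: hyperedges are all singletons and all two-element subsets (complete graph). - Operahedra: line graphs of (planar) trees with $n+2$ vertices, with any total order on their vertices: the vertices of the line graph are the $n+1$ edges of the tree, and two are joined by an edge when they share a vertex of the tree; hyperedges are the singletons and the graph edges. (Equivalently, connected clawfree block graphs.) - Contextual graph-associahedra: all contextual hypergraphs whose hyperedges are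 singletons and two-element sets (connected graphs), with every possible total order on the vertices. - Contextual nestohedra: all contextual hypergraphs, with every possible total order on the vertices. *)

(* Defs.v *)
From mathcomp Require Import all_boot.

Set Implicit Arguments.
Unset Strict Implicit.
Unset Printing Implicit Defensive.

(* A hypergraph lives in an ambient finite type [T]; its vertex set is an
   arbitrary subset of [T], so that restrictions need no change of type. *)
Record hypergraph (T : finType) := Hypergraph {
  verts : {set T};
  hedges : {set {set T}};
  hedges_neq0 : set0 \notin hedges;
  hedges_cover : cover hedges = verts;
  hedges_atomic : forall x, x \in verts -> [set x] \in hedges }.

Section Hypergraphs.
Variable T : finType.
Implicit Types (G : hypergraph T) (X Y Z : {set T}).

Definition hedges_in G X : {set {set T}} := [set Z in hedges G | Z \subset X].

Lemma hedges_in_neq0 G X : set0 \notin hedges_in G X.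
Proof. by rewrite inE (negbTE (hedges_neq0 G)). Qed.

Lemma hedges_in_cover G X : cover (hedges_in G X) = verts G :&: X.
Proof.
apply/setP=> x; rewrite inE; apply/bigcupP/andP.
  case=> Z; rewrite inE => /andP[GZ sZX] Zx; split; last exact: (subsetP sZX).
  by rewrite -hedges_cover; apply/bigcupP; exists Z.
case=> Gx Xx; exists [set x]; last by rewrite inE.
by rewrite inE hedges_atomic // sub1set.
Qed.

Lemma hedges_in_atomic G X x :
  x \in verts G :&: X -> [set x] \in hedges_in G X.
Proof.
by rewrite inE => /andP[Gx Xx]; rewrite inE hedges_atomic // sub1set.
Qed.

(* For [X] not contained in [verts G], the vertex set is cut down to
   [verts G :&: X]; the same convention holds for [reconnect] below. *)
Definition restrict G X : hypergraph T :=
  Hypergraph (hedges_in_neq0 G X) (hedges_in_cover G X)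
             (@hedges_in_atomic G X).

Definition remove G X : hypergraph T := restrict G (verts G :\: X).

Definition splits G X1 X2 : bool :=
  [&& X1 != set0, X2 != set0, X1 :|: X2 == verts G, [disjoint X1 & X2]
    & hedges G == hedges (restrict G X1) :|: hedges (restrict G X2)].

Definition connected G : bool :=
  (verts G != set0) && ~~ [exists X1, exists X2, splits G X1 X2].

Definition Sat G : {set {set T}} :=
  [set X : {set T} | [&& X \subset verts G, X != set0 & connected (restrict G X)]].

Definition decomposition G (P : {set {set T}}) : bool :=
  [&& partition P (verts G), [forall C in P, connected (restrict G C)]
    & hedges G == \bigcup_(C in P) hedges (restrict G C)].

Definition component G C : Prop :=
  exists2 P : {set {set T}}, decomposition G P & C \in P.

Lemma Sat1 G x : x \in verts G -> [set x] \in Sat G.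
Proof.
move=> Gx; have Vx: verts G :&: [set x] = [set x].
  by apply/setIidPr; rewrite sub1set.
have x0 : [set x] != set0 by apply/set0Pn; exists x; rewrite inE.
rewrite inE sub1set Gx x0 /connected /= Vx x0 /=.
apply/existsPn=> X1; apply/existsPn=> X2.
apply/negP=> /and5P[/set0Pn[y X1y] /set0Pn[z X2z] /eqP/= + dX _].
rewrite Vx => /setP eX.
have /set1P ey : y \in [set x] by rewrite -eX inE X1y.
have /set1P ez : z \in [set x] by rewrite -eX inE X2z orbT.
by move: X2z; rewrite ez -ey (disjointFr dX X1y).
Qed.

Definition hedges_cap G X : {set {set T}} :=
  [set Z :&: X | Z in Sat G & Z :&: X != set0].

Lemma hedges_cap_neq0 G X : set0 \notin hedges_cap G X.
Proof. by apply/imsetP=> -[Z]; rewrite inE => /andP[_ /eqP nZX] /esym. Qed.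

Lemma hedges_cap_atomic G X x :
  x \in verts G :&: X -> [set x] \in hedges_cap G X.
Proof.
rewrite inE => /andP[Gx Xx].
have xX : [set x] :&: X = [set x] by apply/setIidPl; rewrite sub1set.
apply/imsetP; exists [set x] => //; rewrite inE Sat1 //= xX.
by apply/set0Pn; exists x; rewrite inE.
Qed.

Lemma hedges_cap_cover G X : cover (hedges_cap G X) = verts G :&: X.
Proof.
apply/setP=> x; apply/bigcupP/idP.
  case=> _ /imsetP[Z + ->]; rewrite !inE => /andP[/and3P[sZG _ _] _].
  by case/andP=> Zx ->; rewrite (subsetP sZG).
by move=> GXx; exists [set x]; [apply: hedges_cap_atomic | rewrite inE].
Qed.

Definition reconnect G X : hypergraph T :=
  Hypergraph (hedges_cap_neq0 G X) (hedges_cap_cover G X)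
             (@hedges_cap_atomic G X).

(* The two reconnected restrictions both have vertex set [X], so comparing
   their hyperedges amounts to comparing the hypergraphs. *)
Definition contextual G : Prop :=
  connected G /\
  forall Y, Y \in Sat G -> 3 <= #|Y| ->
  forall X, X \subset Y -> #|X| = 3 ->
    hedges (reconnect G X) = hedges (reconnect (restrict G Y) X).

Definition total_order_on (V : {set T}) (r : rel T) : Prop :=
  [/\ {in V, reflexive r}, {in V &, antisymmetric r},
      {in V & &, transitive r} & {in V &, total r}].

Lemma total_order_onS (U V : {set T}) (r : rel T) :
  U \subset V -> total_order_on V r -> total_order_on U r.
Proof.
move=> /subsetP sUV [r1 r2 r3 r4]; split.
- by move=> x /sUV; apply: r1.
- by move=> x y /sUV Vx /sUV; apply: r2.
- by move=> y x z /sUV Vy /sUV Vx /sUV; apply: r3.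
- by move=> x y /sUV Vx /sUV; apply: r4.
Qed.

End Hypergraphs.

(* Only the values of [ole] on the vertices are meaningful. *)
Record ohypergraph (T : finType) := OHypergraph {
  ohyp :> hypergraph T;
  ole : rel T;
  ole_total : total_order_on (verts ohyp) ole }.

Section OrderedHypergraphs.
Variable T : finType.
Implicit Types (G : ohypergraph T) (X : {set T}).

Definition orestrict G X : ohypergraph T :=
  @OHypergraph T (restrict G X) (ole G)
    (total_order_onS (subsetIl (verts G) X) (ole_total G)).

Definition oremove G X : ohypergraph T := orestrict G (verts G :\: X).

Definition oreconnect G X : ohypergraph T :=
  @OHypergraph T (reconnect G X) (ole G)
    (total_order_onS (subsetIl (verts G) X) (ole_total G)).

(* Hypergraphs with the same saturation define the same polytope; membership in
   a family is always understood up to this identification, see [member]. *)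
Definition identified G G' : Prop :=
  [/\ verts G = verts G', {in verts G &, ole G =2 ole G'} & Sat G = Sat G'].

End OrderedHypergraphs.

Definition family := forall T : finType, ohypergraph T -> Prop.

Definition member (F : family) (T : finType) (G : ohypergraph T) : Prop :=
  exists2 G' : ohypergraph T, F T G' & identified G G'.

Definition member_dim (F : family) (n : nat) (T : finType)
    (G : ohypergraph T) : Prop :=
  member F G /\ #|verts G| = n.+1.

Definition contextual_family (F : family) : Prop :=
  [/\ forall (T : finType) (G : ohypergraph T), member F G -> contextual G,
      forall (T : finType) (G : ohypergraph T) (X C : {set T}),
        member F G -> X \subset verts G -> component (remove G X) C ->
        member F (orestrict (oremove G X) C)
    & forall (T : finType) (G : ohypergraph T) (X : {set T}),
        member F G -> X \subset verts G -> #|X| = 3 ->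
        member_dim F 2 (oreconnect G X)].

Definition singletons (T : finType) (V : {set T}) : {set {set T}} :=
  [set [set x] | x in V].

Definition simplices : family := fun T G =>
  verts G != set0 /\ hedges G = verts G |: singletons (verts G).

Definition initial_segment (T : finType) (G : ohypergraph T) (x : T) : {set T} :=
  [set y in verts G | ole G y x].

Definition cubes : family := fun T G =>
  verts G != set0 /\
  hedges G = singletons (verts G) :|: [set initial_segment G x | x in verts G].

Definition olt (T : finType) (G : ohypergraph T) : rel T :=
  [rel x y | (x != y) && ole G x y].

Definition consecutive (T : finType) (G : ohypergraph T) (x y : T) : bool :=
  olt G x y && ~~ [exists z in verts G, olt G x z && olt G z y].

Definition graph_hedges (T : finType) (V : {set T}) (e : rel T) :
    {set {set T}} :=
  singletons V :|: [set [set x; y] | x in V, y in V & e x y].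

Definition associahedra : family := fun T G =>
  verts G != set0 /\ hedges G = graph_hedges (verts G) (consecutive G).

Definition permutahedra : family := fun T G =>
  verts G != set0 /\
  hedges G = graph_hedges (verts G) [rel x y | x != y].

Definition is_tree (W : finType) (e : rel W) : Prop :=
  [/\ 0 < #|W|, symmetric e, irreflexive e, forall u v, connect e u v
    & forall c : seq W, ucycle e c -> size c < 3].

Definition tree_edges (W : finType) (e : rel W) : {set {set W}} :=
  [set [set uv.1; uv.2] | uv : W * W & e uv.1 uv.2].

(* The order of [G] is unconstrained here and in the two families below.
   [f] labels the edges of the tree bijectively by the vertices of [G]. The
   planar structure of the tree plays no role in its line graph. *)
Definition operahedra : family := fun T G =>
  verts G != set0 /\
  exists (W : finType) (e : rel W) (f : T -> {set W}),
    [/\ is_tree e, #|W| = #|verts G|.+1, {in verts G &, injective f},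
        f @: verts G = tree_edges e
      & hedges G = graph_hedges (verts G)
                     [rel x y | (x != y) && (f x :&: f y != set0)]].

Definition contextual_graph_associahedra : family := fun T G =>
  contextual G /\
  forall Z, Z \in hedges G -> #|Z| = 1 \/ #|Z| = 2.

Definition contextual_nestohedra : family := fun T G => contextual G.

(* Main.v *)
Require Import Defs.
From mathcomp Require Import all_boot.
From mathcomp Require Import zify.

(** All the notions involved depend only on the saturation, that is, on the
    family of connected sets, which is the closure of the hyperedges under
    unions of sets that meet ([sat_joins], [sat_least]). Three remarks then
    give the theorem.

    Contextuality. If connected sets that meet have a connected intersection, the
    hypergraph is contextual: the trace on X of a connected set Z is also the
    trace of the connected set Z :&: Y, for every connected Y containing X
    ([contextual_meets]). In a simplex or a cube, connected sets that meet are
    nested; the connected sets of an associahedron are the intervals, and those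
    of a permutahedron are all non-empty sets. For the line graph of a tree,
    they are the edge sets of subtrees; they are closed under intersection
    because a set of edges has more endpoints than edges, with an excess of
    exactly one when it is connected ([intersecting_meets]).

    Components. A component of G minus X is a connected set C of G, and each
    family is stable under restriction to a connected set; for operahedra the
    restriction is the line graph of the subtree spanned by C
    ([subtree_is_tree]). Contextuality itself is also stable
    ([contextual_restrict]).

    Three vertices. The hyperedges of a reconnected restriction are already
    saturated ([sat_reconnect]), and any connected hypergraph on three vertices
    is contextual ([contextual_card3]). For simplices, cubes, associahedra and
    permutahedra, traces of connected sets are computed directly. For a
    connected graph, at least two of the three pairs of vertices are traces of
    connected sets ([reconnect3_path]): if x separates y from z, a connected set
    grown from y can reach x while avoiding z. So the reconnected restriction
    is a path or a triangle, and these are the line graphs of the path and of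
    the star with four vertices. *)

Set Implicit Arguments.
Unset Strict Implicit.
Unset Printing Implicit Defensive.

(** * Connected sets of a hypergraph *)

Section Saturation.
Variable T : finType.
Implicit Types (G : hypergraph T) (A B C X Y Z : {set T}) (S : {set {set T}}).

Lemma hedge_sub G Z : Z \in hedges G -> Z \subset verts G.
Proof. by move=> GZ; rewrite -hedges_cover; apply: bigcup_sup. Qed.

Lemma hedge_neq0 G Z : Z \in hedges G -> Z != set0.
Proof. by apply: contraTneq => ->; apply: hedges_neq0. Qed.

Lemma set1_neq0 (x : T) : [set x] != set0.
Proof. by apply/set0Pn; exists x; rewrite inE. Qed.

Definition crosses Z A := (Z :&: A != set0) && ~~ (Z \subset A).

(** A splitting amounts to a set A and its complement with no hyperedge meeting
    both, so connectedness says that every proper non-empty set is crossed by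
    a hyperedge. Every connectivity argument below uses this form. *)
Lemma connectedP G :
  reflect (verts G != set0 /\
           forall A, A \proper verts G -> A != set0 ->
             exists2 Z, Z \in hedges G & crosses Z A)
          (connected G).
Proof.
apply: (iffP andP) => -[V0 cG]; split=> //.
  move=> A /andP[sAV nsVA] A0; apply/exists_inP; apply: contraNT cG.
  move=> /exists_inPn nZ; apply/existsP; exists A; apply/existsP.
  exists (verts G :\: A); apply/and5P; split=> //.
  - by rewrite setD_eq0.
  - by rewrite setDE setUIr setUCr setIT; apply/eqP/setUidPr.
  - by rewrite -setI_eq0 setDE setICA setICr setI0.
  apply/eqP/setP=> Z; rewrite !inE -andb_orr.
  have [GZ /=|//] := boolP (Z \in hedges G).
  rewrite subsetD (hedge_sub GZ) -setI_eq0 /=.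
  by have := nZ Z GZ; rewrite negb_and !negbK orbC.
apply/existsP=> -[X1] /existsP[X2] /and5P[X10 X20 /eqP eV dX /eqP eG].
have [||Z GZ /andP[ZX1 nZX1]] := cG X1; first 2 last.
- move: GZ; rewrite eG !inE (negPf nZX1) andbF /= => /andP[_ sZ2].
  case/set0Pn: ZX1 => z /setIP[/(subsetP sZ2) z2 z1].
  by move: z2; rewrite (disjointFr dX z1).
- rewrite properE -eV subsetUl /= subUset subxx /=.
  case/set0Pn: X20 => y y2; apply/subsetPn; exists y => //.
  by rewrite (disjointFl dX y2).
by [].
Qed.

Lemma satP G X :
  reflect [/\ X \subset verts G, X != set0 &
           forall A, A \proper X -> A != set0 ->
             exists Z, [/\ Z \in hedges G, Z \subset X & crosses Z A]]
          (X \in Sat G).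
Proof.
rewrite inE; apply: (iffP and3P) => -[sXV X0 cX]; split=> //.
  move/connectedP: cX => [_]; rewrite /= (setIidPr sXV) => cX A pA A0.
  have [Z] := cX A pA A0; rewrite inE => /andP[GZ sZX] cZ.
  by exists Z; rewrite GZ sZX.
apply/connectedP; rewrite /= (setIidPr sXV); split=> // A pA A0.
have [Z [GZ sZX cZ]] := cX A pA A0.
by exists Z; rewrite // inE GZ.
Qed.

Lemma sat_sub G X : X \in Sat G -> X \subset verts G.
Proof. by case/satP. Qed.

Lemma sat_neq0 G X : X \in Sat G -> X != set0.
Proof. by case/satP. Qed.

Lemma connected_sat G : connected G = (verts G \in Sat G).
Proof.
apply/connectedP/satP => [[V0 cV]|[_ V0 cV]]; split=> // A pA A0.
  by have [Z GZ cZ] := cV A pA A0; exists Z; rewrite GZ hedge_sub.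
by have [Z [GZ _ cZ]] := cV A pA A0; exists Z.
Qed.

Lemma hedge_sat G Z : Z \in hedges G -> Z \in Sat G.
Proof.
move=> GZ; apply/satP; split; rewrite ?hedge_sub ?(hedge_neq0 GZ) //.
move=> A /andP[sAZ nsZA] A0; exists Z; rewrite GZ subxx; split=> //.
by rewrite /crosses (setIidPr sAZ) A0.
Qed.

Definition joins S :=
  forall A B, A \in S -> B \in S -> A :&: B != set0 -> A :|: B \in S.

Definition meets S :=
  forall A B, A \in S -> B \in S -> A :&: B != set0 -> A :&: B \in S.

(** Let X and Y be connected with a common point x. A crossing of A and a
    crossing of its complement are the same thing, so A may be assumed to
    contain x; then A meets both X and Y and cuts the one that it does not
    contain. *)
Lemma sat_joins G : joins (Sat G).
Proof.
have main X Y A : X \in Sat G -> A :&: X != set0 -> ~~ (X \subset A) ->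
    exists Z, [/\ Z \in hedges G, Z \subset X :|: Y & crosses Z A].
  move=> /satP[_ _ cX] AX nXA.
  have [||Z [GZ sZX /andP[ZA nZA]]] := cX (A :&: X) => //.
    by rewrite properE subsetIr subsetI subxx andbT.
  exists Z; split=> //; first exact: subset_trans sZX (subsetUl _ _).
  rewrite /crosses; apply/andP; split.
    by apply: contraNneq ZA => Z0; rewrite setIA Z0 set0I.
  by apply: contraNN nZA => ZA'; rewrite subsetI ZA'.
move=> X Y SX SY XY; apply/satP; split.
- by rewrite subUset !sat_sub.
- by rewrite setU_eq0 negb_and (sat_neq0 SX).
move=> A /andP[sA nsA] A0.
have [x XYx] := set0Pn _ XY; case/setIP: XYx => Xx Yx.
wlog Ax : A sA nsA A0 / x \in A.
  move=> H; have [|Ax] := boolP (x \in A); first exact: H.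
  have [||||Z [GZ sZ /andP[ZB nZB]]] := H ((X :|: Y) :\: A).
  - exact: subsetDl.
  - case/set0Pn: A0 => a Aa; apply/subsetPn; exists a; last by rewrite inE Aa.
    exact: (subsetP sA).
  - by rewrite setD_eq0.
  - by rewrite !inE Ax Xx.
  exists Z; split=> //; apply/andP; split.
    by move: nZB; rewrite subsetD sZ /= -setI_eq0.
  apply: contraNN ZB => sZA; rewrite setIDA setD_eq0.
  exact: subset_trans (subsetIl _ _) sZA.
have AX : A :&: X != set0 by apply/set0Pn; exists x; rewrite inE Ax.
have AY : A :&: Y != set0 by apply/set0Pn; exists x; rewrite inE Ax.
move: nsA; rewrite subUset negb_and => /orP[nXA|nYA]; first exact: main.
by rewrite setUC; apply: main.
Qed.

(** The connected sets are thus the least family closed under intersecting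
    unions that contains the hyperedges: a maximal member of S inside a connected
    set X is X, since otherwise a hyperedge crossing it could be joined to it. *)
Lemma sat_least G S : joins S -> hedges G \subset S -> Sat G \subset S.
Proof.
move=> jS /subsetP sGS; apply/subsetP=> X /satP[sXV X0 cX].
have [x Xx] := set0Pn _ X0.
pose P := [pred U : {set T} | (U \in S) && (U \subset X)].
have Px : P [set x].
  by rewrite /= sub1set Xx sGS // hedges_atomic // (subsetP sXV).
have [U /maxsetP[/andP[SU sUX] maxU] xU] := maxset_exists Px.
have [<- //|nUX] := eqVneq U X.
have U0 : U != set0 by apply/set0Pn; exists x; rewrite -sub1set.
have [|Z [GZ sZX /andP[ZU /negP[]]]] := cX U _ U0.
  by rewrite properEneq nUX.
rewrite -(maxU (Z :|: U)) ?subsetUl ?subsetUr //=.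
by rewrite subUset sZX sUX jS // sGS.
Qed.

Lemma sat_of_joins G : joins (hedges G) -> Sat G = hedges G.
Proof.
move=> jG; apply/eqP; rewrite eqEsubset sat_least //=.
by apply/subsetP=> Z; apply: hedge_sat.
Qed.

Lemma sat_restrict G Y : Sat (restrict G Y) = [set X in Sat G | X \subset Y].
Proof.
apply/setP=> X; rewrite inE; apply/satP/andP.
  case=> /=; rewrite subsetI => /andP[sXV sXY] X0 cX; split=> //.
  apply/satP; split=> // A pA A0; have [Z []] := cX A pA A0.
  by rewrite inE => /andP[GZ _]; exists Z.
case=> /satP[sXV X0 cX] sXY; split; rewrite //= ?subsetI ?sXV // => A pA A0.
have [Z [GZ sZX cZ]] := cX A pA A0; exists Z; split=> //.
by rewrite inE GZ (subset_trans sZX).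
Qed.

Lemma sat_restrict_restrict G X Y :
  Y \subset X -> Sat (restrict (restrict G X) Y) = Sat (restrict G Y).
Proof.
move=> sYX; apply/setP=> Z; rewrite !sat_restrict !inE -andbA.
by have [sZY|] := boolP (Z \subset Y); rewrite ?andbF // (subset_trans sZY sYX).
Qed.

Lemma hedges_capP G X B :
  reflect (exists Z, [/\ Z \in Sat G, B = Z :&: X & B != set0])
          (B \in hedges_cap G X).
Proof.
apply: (iffP imsetP) => [[Z]|[Z [SZ -> ZX]]].
  by rewrite inE => /andP[SZ ZX] ->; exists Z.
by exists Z; rewrite // inE SZ.
Qed.

(** Traces on X that meet come from connected sets that meet, so the hyperedges
    of a reconnected restriction are already saturated. *)
Lemma sat_reconnect G X : Sat (reconnect G X) = hedges_cap G X.
Proof.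
apply: sat_of_joins => _ _ /hedges_capP[Y [SY -> Y0]] /hedges_capP[Z [SZ -> Z0]].
move=> YZ; apply/hedges_capP; exists (Y :|: Z); rewrite setIUl.
split=> //; last by rewrite setU_eq0 negb_and Y0.
apply: sat_joins => //; apply: contraNneq YZ => YZ0.
by rewrite setIACA YZ0 set0I.
Qed.

Lemma reconnect_connected G X : verts G \in Sat G ->
  verts G :&: X != set0 -> connected (reconnect G X).
Proof.
move=> SV X0; rewrite connected_sat sat_reconnect.
by apply/hedges_capP; exists (verts G).
Qed.

Lemma hedges_cap_mono G G' X :
  Sat G \subset Sat G' -> hedges_cap G X \subset hedges_cap G' X.
Proof.
move=> /subsetP sS; apply/subsetP=> _ /hedges_capP[Z [SZ -> Z0]].
by apply/hedges_capP; exists Z; rewrite sS.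
Qed.

Lemma hedges_cap_sat G G' X : Sat G = Sat G' -> hedges_cap G X = hedges_cap G' X.
Proof. by rewrite /hedges_cap => ->. Qed.

(** If connected sets that meet have a connected intersection, then the trace
    of Z on a subset X of Y is also the trace of the connected set Z :&: Y. *)
Lemma contextual_meets G : verts G \in Sat G -> meets (Sat G) -> contextual G.
Proof.
move=> SV mS; split; first by rewrite connected_sat.
move=> Y SY _ X sXY _; apply/eqP.
rewrite eqEsubset [X in _ && X]hedges_cap_mono ?andbT; last first.
  by rewrite sat_restrict; apply/subsetP=> Z; rewrite inE => /andP[].
apply/subsetP=> _ /hedges_capP[Z [SZ -> ZX]]; apply/hedges_capP.
exists (Z :&: Y); rewrite -setIA (setIidPr sXY); split=> //.
rewrite sat_restrict inE subsetIr mS //.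
by apply: contraNneq ZX => ZY; rewrite -(setIidPr sXY) setIA ZY set0I.
Qed.

(** For Y inside C the traces coming from connected subsets of C lie between
    those coming from Y and those coming from the whole hypergraph, and
    contextuality makes the two extremes coincide. *)
Lemma contextual_restrict G C :
  contextual G -> C \in Sat G -> contextual (restrict G C).
Proof.
move=> [_ ctx] SC; split; first by move: SC; rewrite inE => /and3P[].
move=> Y; rewrite sat_restrict inE => /andP[SY sYC] Y3 X sXY X3.
apply/eqP; rewrite eqEsubset /= (hedges_cap_sat _ (sat_restrict_restrict G sYC)).
have /= <- := ctx Y SY Y3 X sXY X3; apply/andP; split.
  apply: hedges_cap_mono; rewrite sat_restrict.
  by apply/subsetP=> Z; rewrite inE => /andP[].
have /= -> := ctx Y SY Y3 X sXY X3; apply: hedges_cap_mono.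
rewrite !sat_restrict; apply/subsetP=> Z; rewrite !inE => /andP[->].
by move/subset_trans; apply.
Qed.

(** A set Y with three elements is then the whole vertex set, for which the
    condition is trivial. *)
Lemma contextual_card3 G : connected G -> #|verts G| = 3 -> contextual G.
Proof.
move=> cG V3; split=> // Y SY Y3 X _ _.
have -> : Y = verts G by apply/eqP; rewrite eqEcard sat_sub // V3.
apply: hedges_cap_sat; rewrite sat_restrict; apply/setP=> Z; rewrite inE.
by case: (boolP (Z \in Sat G)) => // /sat_sub->.
Qed.

Lemma contextual_sat G G' :
  verts G = verts G' -> Sat G = Sat G' -> contextual G' -> contextual G.
Proof.
move=> eV eS [cG' ctx]; split; first by rewrite connected_sat eV eS -connected_sat.
move=> Y; rewrite eS => SY Y3 X sXY X3 /=; rewrite (hedges_cap_sat _ eS).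
have /= -> := ctx Y SY Y3 X sXY X3.
by apply: hedges_cap_sat; rewrite !sat_restrict eS.
Qed.

End Saturation.

(** * Contextual families *)

Section Families.
Variable T : finType.
Implicit Types (G H : ohypergraph T) (C X : {set T}).

Lemma identified_trans G2 G1 G3 :
  identified G1 G2 -> identified G2 G3 -> identified G1 G3.
Proof.
case=> eV eR eS [eV' eR' eS']; split; rewrite ?eV ?eS // => x y Vx Vy.
by rewrite eR ?eV // eR'.
Qed.

Lemma identified_restrict G H C :
  identified G H -> identified (orestrict G C) (orestrict H C).
Proof.
case=> eV eR eS; split; rewrite /= ?eV ?sat_restrict ?eS // -eV.
by move=> x y /setIP[Vx _] /setIP[Vy _]; apply: eR.
Qed.

Lemma identified_reconnect G H X :
  identified G H -> identified (oreconnect G X) (oreconnect H X).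
Proof.
case=> eV eR eS; split; rewrite /= ?eV ?sat_reconnect ?(hedges_cap_sat _ eS) //.
by rewrite -eV => x y /setIP[Vx _] /setIP[Vy _]; apply: eR.
Qed.

Lemma component_sat (G : hypergraph T) X C :
  component (remove G X) C -> C \in Sat G /\ C \subset verts G :\: X.
Proof.
case=> P /and3P[/and3P[/eqP cP _ P0] /forall_inP cC _] PC.
have : C \in Sat (remove G X).
  rewrite inE cC // -cP bigcup_sup //= andbT.
  by apply: contraNneq P0 => <-.
by rewrite sat_restrict inE => /andP[].
Qed.

Lemma identified_remove G X C : C \subset verts G :\: X ->
  identified (orestrict (oremove G X) C) (orestrict G C).
Proof.
move=> sC; split=> //=; last exact: sat_restrict_restrict.
by rewrite -setIA (setIidPr sC).
Qed.

End Families.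

(** Restriction and reconnection respect the identification of hypergraphs with
    the same saturation, so the conditions may be checked on representatives;
    moreover removing X and passing to a component amounts to restricting to a
    connected set. *)
Lemma contextual_familyP (F : Defs.family) :
  (forall (T : finType) (G : ohypergraph T), F T G -> contextual G) ->
  (forall (T : finType) (G : ohypergraph T) (C : {set T}),
     F T G -> C \in Sat G -> member F (orestrict G C)) ->
  (forall (T : finType) (G : ohypergraph T) (X : {set T}),
     F T G -> X \subset verts G -> #|X| = 3 -> member F (oreconnect G X)) ->
  contextual_family F.
Proof.
move=> F1 F2 F3; split.
- by move=> T G [G' FG' [eV _ eS]]; apply: contextual_sat eV eS (F1 _ _ FG').
- move=> T G X C [G' FG' eG] sX /component_sat[SC sC].
  have [|H FH eH] := F2 _ _ C FG'; first by case: eG => _ _ <-.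
  exists H; first exact: FH.
  apply: identified_trans (identified_remove sC) _.
  exact: identified_trans (identified_restrict C eG) eH.
move=> T G X [G' FG' eG] sX X3; split; last by rewrite /= (setIidPr sX).
have [|H FH eH] := F3 _ _ X FG' _ X3; first by case: eG => <-.
exists H; first exact: FH.
exact: identified_trans (identified_reconnect X eG) eH.
Qed.

Lemma member_self (F : Defs.family) (T : finType) (G : ohypergraph T) :
  F T G -> member F G.
Proof. by exists G. Qed.

Lemma contextual_nestohedra_contextual : contextual_family contextual_nestohedra.
Proof.
apply: contextual_familyP => //.
  by move=> T G C cG SC; apply/member_self/contextual_restrict.
move=> T G X [cG _] sX X3; apply/member_self/contextual_card3 => /=.
  apply: reconnect_connected; first by rewrite -connected_sat.
  by rewrite (setIidPr sX) -card_gt0 X3.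
by rewrite (setIidPr sX).
Qed.

(** * Simplices and cubes *)

Section Chains.
Variable T : finType.
Implicit Types (G : hypergraph T) (A B C V X : {set T}) (K : {set {set T}}).

(** Simplices and cubes both have for hyperedges the singletons together with a
    chain of sets. Two such hyperedges that meet are nested, hence their
    union and intersection are again hyperedges. *)
Definition chain K := {in K &, forall A B, (A \subset B) || (B \subset A)}.

Lemma singletonsP V B :
  reflect (exists2 x, x \in V & B = [set x]) (B \in singletons V).
Proof. exact: imsetP. Qed.

Lemma singletons1 V x : ([set x] \in singletons V) = (x \in V).
Proof. by apply: mem_imset; apply: set1_inj. Qed.

Lemma set1_meet x B : [set x] :&: B != set0 -> [set x] \subset B.
Proof. by case/set0Pn=> y /setIP[/set1P-> Bx]; rewrite sub1set. Qed.

Lemma singletons_chain_nested V K A B : chain K ->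
  A \in singletons V :|: K -> B \in singletons V :|: K ->
  A :&: B != set0 -> (A \subset B) || (B \subset A).
Proof.
move=> cK /setUP[/singletonsP[x _ ->] _ /set1_meet-> //|KA].
move=> /setUP[/singletonsP[x _ ->]|KB _]; last exact: cK.
by rewrite setIC => /set1_meet->; rewrite orbT.
Qed.

Lemma singletons_chain_joins V K : chain K -> joins (singletons V :|: K).
Proof.
move=> cK A B KA KB AB; have := singletons_chain_nested cK KA KB AB.
by case/orP=> [/setUidPr->|/setUidPl->].
Qed.

Lemma singletons_chain_meets V K : chain K -> meets (singletons V :|: K).
Proof.
move=> cK A B KA KB AB; have := singletons_chain_nested cK KA KB AB.
by case/orP=> [/setIidPl->|/setIidPr->].
Qed.

End Chains.

Section Simplices.
Variables (T : finType) (G : ohypergraph T).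
Hypothesis simplexG : simplices G.
Implicit Types (C X : {set T}).

Lemma simplex_hedges : hedges G = singletons (verts G) :|: [set verts G].
Proof. by case: simplexG => _ ->; rewrite setUC. Qed.

Lemma simplex_chain : chain [set verts G].
Proof. by move=> A B /set1P-> /set1P->; rewrite subxx. Qed.

Lemma sat_simplex : Sat G = hedges G.
Proof.
apply: sat_of_joins; rewrite simplex_hedges.
exact/singletons_chain_joins/simplex_chain.
Qed.

Lemma simplex_contextual : contextual G.
Proof.
apply: contextual_meets; rewrite sat_simplex simplex_hedges.
  by rewrite !inE eqxx orbT.
exact/singletons_chain_meets/simplex_chain.
Qed.

Lemma simplex_restrict C : C \in Sat G -> simplices (orestrict G C).
Proof.
move=> SC; split; rewrite /= (setIidPr (sat_sub SC)) ?(sat_neq0 SC) //.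
apply/setP=> Z; rewrite inE; apply/andP/setU1P.
  rewrite simplex_hedges => -[/setUP[/singletonsP[x _ ->]|/set1P->]] sZ.
    by right; rewrite singletons1 -sub1set.
  by left; apply/eqP; rewrite eqEsubset sZ sat_sub.
case=> [->|/singletonsP[x Cx ->]]; first by rewrite -sat_simplex.
rewrite sub1set Cx; split=> //; apply: hedges_atomic.
by apply: subsetP Cx; apply: sat_sub.
Qed.

Lemma simplex_reconnect X : X \subset verts G -> X != set0 ->
  simplices (oreconnect G X).
Proof.
move=> sX X0; split; rewrite /= (setIidPr sX) //.
apply/setP=> B; apply/hedges_capP/setU1P.
  rewrite sat_simplex simplex_hedges.
  case=> Z [/setUP[/singletonsP[x _ ->]|/set1P->]] -> => [/set1_meet xX|_].
    by right; rewrite (setIidPl xX) singletons1 -sub1set.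
  by left; apply/setIidPr.
case=> [->|/singletonsP[x Xx ->]].
  exists (verts G); rewrite (setIidPr sX) sat_simplex simplex_hedges.
  by rewrite !inE eqxx orbT.
exists [set x]; rewrite Sat1 ?(subsetP sX) // set1_neq0; split=> //.
by apply/esym/setIidPl; rewrite sub1set.
Qed.

End Simplices.

Lemma simplices_contextual : contextual_family simplices.
Proof.
apply: contextual_familyP => T G; first exact: simplex_contextual.
  by move=> C sG SC; apply/member_self/simplex_restrict.
move=> X sG sX X3; apply/member_self/simplex_reconnect => //.
by rewrite -card_gt0 X3.
Qed.

Section Segments.
Variables (T : finType) (G : ohypergraph T).
Implicit Types (x y z : T) (A C X : {set T}).

Lemma ole_refl x : x \in verts G -> ole G x x.
Proof. by case: (ole_total G) => + _ _ _; apply. Qed.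

Lemma ole_anti x y :
  x \in verts G -> y \in verts G -> ole G x y -> ole G y x -> x = y.
Proof. by case: (ole_total G) => _ + _ _ Vx Vy xy yx; apply; rewrite ?xy. Qed.

Lemma ole_trans y x z : x \in verts G -> y \in verts G -> z \in verts G ->
  ole G x y -> ole G y z -> ole G x z.
Proof. by case: (ole_total G) => _ _ + _ Vx Vy Vz; apply. Qed.

Lemma ole_or x y : x \in verts G -> y \in verts G -> ole G x y || ole G y x.
Proof. by case: (ole_total G) => _ _ _; apply. Qed.

Lemma segment_sub x : initial_segment G x \subset verts G.
Proof. by apply/subsetP=> y; rewrite inE => /andP[]. Qed.

Lemma segment_self x : x \in verts G -> x \in initial_segment G x.
Proof. by move=> Vx; rewrite inE Vx ole_refl. Qed.

Lemma segment_le x y : x \in verts G -> y \in verts G -> ole G x y ->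
  initial_segment G x \subset initial_segment G y.
Proof.
move=> Vx Vy xy; apply/subsetP=> z; rewrite !inE => /andP[Vz zx].
by rewrite Vz (ole_trans Vz Vx).
Qed.

Lemma segment_chain : chain [set initial_segment G x | x in verts G].
Proof.
move=> _ _ /imsetP[x Vx ->] /imsetP[y Vy ->].
by case/orP: (ole_or Vx Vy) => /segment_le-> //; rewrite orbT.
Qed.

(** The greatest element of A is the one with the largest initial segment. *)
Lemma exists_greatest A : A \subset verts G -> A != set0 ->
  exists2 m, m \in A & A \subset initial_segment G m.
Proof.
move=> /subsetP sAV /set0Pn[a Aa].
case: (@arg_maxnP _ a [in A] (fun x => #|initial_segment G x|)) => //= m Am maxm.
exists m => //; apply/subsetP=> b Ab; have [Vm Vb] := (sAV m Am, sAV b Ab).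
case/orP: (ole_or Vb Vm) => [bm|/(segment_le Vm Vb) smb]; first by rewrite inE Vb.
suff /eqP-> : initial_segment G m == initial_segment G b by apply: segment_self.
by rewrite eqEcard smb; apply: maxm.
Qed.

Hypothesis cubeG : cubes G.

Lemma sat_cube : Sat G = hedges G.
Proof.
apply: sat_of_joins; case: cubeG => _ ->.
exact/singletons_chain_joins/segment_chain.
Qed.

Lemma cube_meets : meets (Sat G).
Proof.
rewrite sat_cube; case: cubeG => _ ->.
exact/singletons_chain_meets/segment_chain.
Qed.

Lemma segment_sat x : x \in verts G -> initial_segment G x \in Sat G.
Proof.
move=> Vx; rewrite sat_cube; case: cubeG => _ ->.
by rewrite inE imset_f ?orbT.
Qed.

Lemma cube_contextual : contextual G.
Proof.
apply: contextual_meets cube_meets; have [V0 _] := cubeG.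
have [m Vm sVm] := exists_greatest (subxx _) V0.
suff -> : verts G = initial_segment G m by apply: segment_sat.
by apply/eqP; rewrite eqEsubset sVm segment_sub.
Qed.

Lemma segment_restrict C x :
  initial_segment (orestrict G C) x = initial_segment G x :&: C.
Proof. by apply/setP=> y; rewrite !inE /= andbAC. Qed.

Lemma cube_restrict C : C \in Sat G -> cubes (orestrict G C).
Proof.
move=> SC; have sCV := sat_sub SC.
split; rewrite /= (setIidPr sCV) ?(sat_neq0 SC) //.
apply/setP=> Z; rewrite inE; apply/andP/setUP.
  case: cubeG => _ -> [/setUP[/singletonsP[x _ ->]|/imsetP[x Vx ->]]] sZ.
    by left; rewrite singletons1 -sub1set.
  right; apply/imsetP; exists x; first by rewrite (subsetP sZ) ?segment_self.
  by rewrite segment_restrict (setIidPl sZ).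
case=> [/singletonsP[x Cx ->]|/imsetP[x Cx ->]].
  by rewrite sub1set Cx hedges_atomic // (subsetP sCV).
have Vx := subsetP sCV _ Cx.
rewrite segment_restrict subsetIr -sat_cube cube_meets ?segment_sat //.
by apply/set0Pn; exists x; rewrite inE segment_self.
Qed.

Lemma segment_reconnect X x :
  initial_segment (oreconnect G X) x = initial_segment G x :&: X.
Proof. by apply/setP=> y; rewrite !inE /= andbAC. Qed.

(** The trace on X of an initial segment is the initial segment of X that ends at
    the greatest element of this trace. *)
Lemma cube_reconnect X : X \subset verts G -> X != set0 -> cubes (oreconnect G X).
Proof.
move=> sX X0; split; rewrite /= (setIidPr sX) //.
apply/setP=> B; apply/hedges_capP/setUP.
  rewrite sat_cube; case: cubeG => _ ->.
  case=> Z [/setUP[/singletonsP[x _ ->]|/imsetP[x Vx ->]]] -> => [/set1_meet xX|I0].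
    by left; rewrite (setIidPl xX) singletons1 -sub1set.
  have sIV : initial_segment G x :&: X \subset verts G.
    exact: subset_trans (subsetIr _ _) sX.
  have [m Im sIm] := exists_greatest sIV I0.
  have Vm := subsetP sIV _ Im; case/setIP: Im; rewrite inE => /andP[_ mx] Xm.
  right; apply/imsetP; exists m; rewrite // segment_reconnect.
  apply/eqP; rewrite eqEsubset subsetI sIm subsetIr /=.
  by rewrite setSI // segment_le.
case=> [/singletonsP[x Xx ->]|/imsetP[x Xx ->]]; have Vx := subsetP sX _ Xx.
  exists [set x]; rewrite Sat1 // set1_neq0; split=> //.
  by apply/esym/setIidPl; rewrite sub1set.
exists (initial_segment G x); rewrite segment_sat // segment_reconnect.
by split=> //; apply/set0Pn; exists x; rewrite inE segment_self.
Qed.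

End Segments.

Lemma cubes_contextual : contextual_family cubes.
Proof.
apply: contextual_familyP => T G; first exact: cube_contextual.
  by move=> C sG SC; apply/member_self/cube_restrict.
move=> X sG sX X3; apply/member_self/cube_reconnect => //.
by rewrite -card_gt0 X3.
Qed.

(** * Hypergraphs with hyperedges of size at most two *)

Section Graphs.
Variable T : finType.
Implicit Types (x y z : T) (A B C V X Y Z : {set T}) (e : rel T).

Lemma graph_hedgesP V e Z :
  reflect ((exists2 x, x \in V & Z = [set x]) \/
           exists x y, [/\ x \in V, y \in V, e x y & Z = [set x; y]])
          (Z \in graph_hedges V e).
Proof.
apply: (iffP setUP) => -[/singletonsP|]; try by left.
  case/imset2P=> x y Vx; rewrite inE => /andP[Vy exy] ->.
  by right; exists x, y.
case=> x [y [Vx Vy exy ->]]; right; apply/imset2P; exists x y => //.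
by rewrite inE Vy.
Qed.

Lemma graph_hedges_eq V e e' : {in V &, forall x y, x != y -> e x y = e' x y} ->
  graph_hedges V e = graph_hedges V e'.
Proof.
suff sub f f' : {in V &, forall x y, x != y -> f x y = f' x y} ->
    graph_hedges V f \subset graph_hedges V f'.
  by move=> ee; apply/eqP; rewrite eqEsubset !sub // => x y Vx Vy /ee->.
move=> ff; apply/subsetP=> Z /graph_hedgesP[[x Vx ->]|].
  by apply/graph_hedgesP; left; exists x.
case=> x [y [Vx Vy fxy ->]]; apply/graph_hedgesP.
have [<-|nxy] := eqVneq x y; first by left; exists x; rewrite ?setUid.
by right; exists x, y; rewrite -ff.
Qed.

Lemma graph_hedges_neq0 V e : set0 \notin graph_hedges V e.
Proof.
apply/graph_hedgesP=> -[[x _]|[x [y [_ _ _]]]] /setP/(_ x);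
  by rewrite !inE eqxx.
Qed.

Lemma graph_hedges_cover V e : cover (graph_hedges V e) = V.
Proof.
apply/setP=> z; apply/bigcupP/idP => [[Z /graph_hedgesP[[x Vx ->]|]]|Vz].
- by move=> /set1P->.
- by case=> x [y [Vx Vy _ ->]] /set2P[]->.
by exists [set z]; rewrite ?set11 //; apply/graph_hedgesP; left; exists z.
Qed.

Lemma graph_hedges_atomic V e x : x \in V -> [set x] \in graph_hedges V e.
Proof. by move=> Vx; apply/graph_hedgesP; left; exists x. Qed.

Definition graph_hypergraph V e : hypergraph T :=
  Hypergraph (graph_hedges_neq0 V e) (graph_hedges_cover V e)
             (@graph_hedges_atomic V e).

Definition ograph (G : ohypergraph T) e : ohypergraph T :=
  @OHypergraph T (graph_hypergraph (verts G) e) (ole G) (ole_total G).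

Lemma graph_hedges_in (G : hypergraph T) C e :
  hedges G = graph_hedges (verts G) e -> C \subset verts G ->
  hedges_in G C = graph_hedges C e.
Proof.
move=> eG sCV; apply/setP=> Z; rewrite inE eG; apply/andP/graph_hedgesP.
  case=> /graph_hedgesP[[x _ ->]|]; rewrite ?sub1set; first by left; exists x.
  case=> x [y [_ _ exy ->]]; rewrite subUset !sub1set => /andP[Cx Cy].
  by right; exists x, y.
case=> [[x Cx ->]|[x [y [Cx Cy exy ->]]]].
  by rewrite graph_hedges_atomic ?(subsetP sCV) ?sub1set.
rewrite subUset !sub1set Cx Cy; split=> //; apply/graph_hedgesP; right.
by exists x, y; rewrite !(subsetP sCV).
Qed.

(** For these hypergraphs a crossing hyperedge is a pair with one element on
    each side, which is how graphs enter all the connectivity arguments. *)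
Definition graphical (G : hypergraph T) :=
  forall Z, Z \in hedges G -> #|Z| <= 2.

Lemma graph_graphical (G : hypergraph T) e :
  hedges G = graph_hedges (verts G) e -> graphical G.
Proof.
move=> eG Z; rewrite eG => /graph_hedgesP[[x _ ->]|[x [y [_ _ _ ->]]]].
  by rewrite cards1.
by rewrite cards2; case: eqP.
Qed.

Lemma card_le2_crosses Z A : #|Z| <= 2 -> crosses Z A ->
  exists x y, [/\ x \in A, y \notin A & Z = [set x; y]].
Proof.
move=> Z2 /andP[/set0Pn[x /setIP[Zx Ax]] /subsetPn[y Zy nAy]].
exists x, y; split=> //; apply/eqP; rewrite eq_sym eqEcard subUset !sub1set Zx Zy.
rewrite cards2 /=; suff -> : x != y by [].
by apply: contraNneq nAy => <-.
Qed.

Lemma graphical_satP (G : hypergraph T) X : graphical G ->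
  reflect [/\ X \subset verts G, X != set0 &
           forall A, A \proper X -> A != set0 ->
             exists x y, [/\ x \in A, y \in X :\: A & [set x; y] \in hedges G]]
          (X \in Sat G).
Proof.
move=> gG; apply: (iffP (satP _ _)) => -[sXV X0 cX]; split=> // A pA A0.
  have [Z [GZ sZX /(card_le2_crosses (gG Z GZ))[x [y [Ax nAy eZ]]]]] := cX A pA A0.
  exists x, y; rewrite -eZ inE nAy; split=> //.
  by rewrite (subsetP sZX) // eZ set22.
have [x [y [Ax /setDP[Xy nAy] Gxy]]] := cX A pA A0; exists [set x; y].
rewrite Gxy subUset !sub1set Xy (subsetP (proper_sub pA)) //; split=> //.
apply/andP; split; first by apply/set0Pn; exists x; rewrite inE set21.
by apply/subsetPn; exists y; rewrite ?set22.
Qed.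

Lemma graph_edge (G : hypergraph T) e x y :
  hedges G = graph_hedges (verts G) e -> x \in verts G -> y \in verts G ->
  x != y -> ([set x; y] \in hedges G) = e x y || e y x.
Proof.
move=> eG Vx Vy nxy; rewrite eG; apply/graph_hedgesP/orP => [|H].
  case=> [[z _ eZ]|[a [b [_ _ eab eZ]]]].
    by have := cards2 x y; rewrite eZ cards1 nxy.
  have: x \in [set a; b] by rewrite -eZ set21.
  have: y \in [set a; b] by rewrite -eZ set22.
  case/set2P=> ey /set2P[] ex; rewrite ex ey in nxy *;
    by [rewrite eqxx in nxy | left | right].
by right; case: H => exy; [exists x, y | exists y, x; rewrite setUC].
Qed.

(** Take B maximal among the connected sets that contain y but not x. If z is
    not in B, then some edge leaves B because G is connected. By maximality that
    edge can only end at x, and adding x to B gives the second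
    alternative. *)
Lemma graphical_avoid (G : hypergraph T) x y z : graphical G ->
  verts G \in Sat G -> x \in verts G -> y \in verts G -> z \in verts G ->
  x != y -> z != x ->
  (exists B, [/\ B \in Sat G, y \in B, z \in B & x \notin B]) \/
  (exists B, [/\ B \in Sat G, x \in B, y \in B & z \notin B]).
Proof.
move=> gG /(graphical_satP _ gG)[_ _ cV] Vx Vy Vz nxy nzx.
pose P := [pred B | [&& B \in Sat G, y \in B & x \notin B]].
have Py : P [set y] by rewrite /= Sat1 // set11 inE nxy.
have [B /maxsetP[/and3P[SB By nBx] maxB] _] := maxset_exists Py.
have [Bz|nBz] := boolP (z \in B); first by left; exists B.
right; have [||a [b [Ba /setDP[Vb nBb] Gab]]] := cV B.
- rewrite properE sat_sub //; apply/subsetPn; by exists x.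
- exact: sat_neq0 SB.
have SBb : B :|: [set a; b] \in Sat G.
  apply: sat_joins => //; first exact: hedge_sat.
  by apply/set0Pn; exists a; rewrite in_setI Ba set21.
have [eb|nbx] := eqVneq b x.
  exists (B :|: [set a; b]); rewrite SBb !inE By eb eqxx !orbT.
  split=> //; rewrite (negPf nBz) (negPf nzx) orbF.
  by apply: contraNneq nBz => ->.
case/negP: nBb; rewrite -(maxB (B :|: [set a; b])) ?subsetUl //.
  by rewrite !inE eqxx !orbT.
rewrite /= SBb !inE By (negPf nBx) (eq_sym x b) (negPf nbx) orbF.
by apply: contraNneq nBx => ->.
Qed.

Lemma cap_pair (G : hypergraph T) x y z B :
  B \in Sat G -> x \in B -> y \in B -> z \notin B ->
  [set x; y] \in hedges_cap G [set x; y; z].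
Proof.
move=> SB Bx By nBz; apply/hedges_capP; exists B; split=> //.
  apply/setP=> t; rewrite !inE andb_orr.
  have [->|nzt] := eqVneq t z; last first.
    by rewrite andbF orbF; case: eqP => [->|_]; case: eqP => [->|_];
      rewrite ?Bx ?By ?andbF.
  by rewrite (negPf nBz) /=; apply/norP; split; apply: contraNneq nBz => ->.
by apply/set0Pn; exists x; rewrite set21.
Qed.

Lemma cap_pair_or (G : hypergraph T) x y z : graphical G ->
  verts G \in Sat G -> [set x; y; z] \subset verts G -> uniq [:: x; y; z] ->
  ([set y; z] \in hedges_cap G [set x; y; z]) ||
  ([set x; y] \in hedges_cap G [set x; y; z]).
Proof.
move=> gG SV; rewrite !subUset !sub1set -andbA => /and3P[Vx Vy Vz].
rewrite /= !inE negb_or andbT => /andP[/andP[nxy nxz] nyz].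
have [|[B [SB By Bz nBx]]|[B [SB Bx By nBz]]] := graphical_avoid gG SV Vx Vy Vz nxy.
- by rewrite eq_sym.
- have -> : [set x; y; z] = [set y; z; x] by rewrite -setUA setUC.
  by rewrite (cap_pair SB).
by rewrite (cap_pair SB) ?orbT.
Qed.

Lemma card3P X :
  #|X| = 3 -> exists x y z, uniq [:: x; y; z] /\ X = [set x; y; z].
Proof.
move=> X3; have /set0Pn[x Xx] : X != set0 by rewrite -card_gt0 X3.
have /cards2P[y [z [nyz eX]]] : #|X :\ x| == 2.
  by move: X3; rewrite (cardsD1 x) Xx add1n => -[->].
exists x, y, z; rewrite -setUA -eX setD1K // /= !inE andbT nyz andbT; split=> //.
have := set21 y z; have := set22 y z; rewrite -eX !inE eq_sym.
by case/andP=> nzx _ /andP[nyx _]; rewrite negb_or eq_sym nyx.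
Qed.

(** Among three vertices, at most one pair fails to be the trace of a connected
    set, as [cap_pair_or] shows when applied to each vertex in turn. Hence a
    reconnected restriction of a connected graph to three vertices is a
    path x - y - z or a triangle, and never a simplex. *)
Lemma reconnect3_path (G : hypergraph T) X : graphical G ->
  verts G \in Sat G -> X \subset verts G -> #|X| = 3 ->
  exists x y z, [/\ uniq [:: x; y; z], X = [set x; y; z],
    [set x; y] \in hedges_cap G X & [set y; z] \in hedges_cap G X].
Proof.
move=> gG SV sXV /card3P[x [y [z [Uxyz eX]]]].
have main u v w : X = [set u; v; w] -> uniq [:: u; v; w] ->
    ([set v; w] \in hedges_cap G X) || ([set u; v] \in hedges_cap G X).
  by move=> eX' U; rewrite eX' in sXV *; apply: cap_pair_or.
have eX1 : X = [set y; x; z] by rewrite (setUC [set y]).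
have eX2 : X = [set x; z; y] by rewrite -setUA (setUC [set z]) setUA.
have U1 : uniq [:: y; x; z].
  by move: Uxyz; rewrite /= !inE !negb_or (eq_sym y x); do 3!case: eqP.
have U2 : uniq [:: x; z; y].
  by move: Uxyz; rewrite /= !inE !negb_or (eq_sym z y); do 3!case: eqP.
have := main _ _ _ eX1 U1; have := main _ _ _ eX2 U2; have := main _ _ _ eX Uxyz.
rewrite (setUC [set z]) (setUC [set y] [set x]).
have [Sxy|nxy] := boolP ([set x; y] \in hedges_cap G X).
  have [Syz|nyz] := boolP ([set y; z] \in hedges_cap G X).
    by exists x, y, z.
  rewrite orbC => _ Sxz _; exists y, x, z; split=> //.
  by rewrite setUC.
rewrite !orbF => Syz _ Sxz; exists x, z, y; split=> //.
by rewrite setUC.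
Qed.

End Graphs.

(** * Contextual graph-associahedra *)

Section Triples.
Variable T : finType.
Implicit Types (x y z : T) (X Z : {set T}).

(** The graph with the same connected pairs as R. *)
Definition sat_pairs (R : hypergraph T) : rel T := [rel x y | [set x; y] \in Sat R].

(** The only connected set with three elements is x, y, z itself, the union of
    two connected pairs that share y; so R is determined by its pairs. *)
Lemma sat_pairs_graph (R : hypergraph T) x y z : verts R = [set x; y; z] ->
  [set x; y] \in Sat R -> [set y; z] \in Sat R ->
  Sat (graph_hypergraph (verts R) (sat_pairs R)) = Sat R.
Proof.
move=> eV Sxy Syz; set K := graph_hypergraph _ _.
have K1 t : t \in verts R -> [set t] \in Sat K by move=> Vt; apply: Sat1.
have K2 t u : [set t; u] \in Sat R -> [set t; u] \in Sat K.
  move=> Stu; apply/hedge_sat/graph_hedgesP; right; exists t, u.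
  by have := sat_sub Stu; rewrite subUset !sub1set => /andP[].
apply/eqP; rewrite eqEsubset; apply/andP; split.
  apply: sat_least; first exact: sat_joins.
  apply/subsetP=> Z /graph_hedgesP[[t Vt ->]|[t [u [_ _ Stu ->]]]] //.
  exact: Sat1.
apply/subsetP=> Z SZ; have sZV := sat_sub SZ.
have V3 : #|verts R| <= 3.
  by rewrite eV (leq_trans (leq_card_setU _ _)) // cards1 cards2 addn1 !ltnS leq_b1.
have [/cards1P[t eZ]|Z1] := boolP (#|Z| == 1).
  by rewrite eZ K1 // -sub1set -eZ.
have [/cards2P[t [u [_ eZ]]]|Z2] := boolP (#|Z| == 2).
  by rewrite eZ K2 // -eZ.
have Z0 : 0 < #|Z| by rewrite card_gt0 (sat_neq0 SZ).
have -> : Z = [set x; y] :|: [set y; z].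
  apply/eqP; rewrite setUA -(setUA [set x]) setUid -eV eqEcard sZV; lia.
apply: sat_joins; try exact: K2.
by apply/set0Pn; exists y; rewrite !inE eqxx orbT.
Qed.

Lemma identified_sat_pairs (G : ohypergraph T) X x y z :
  X \subset verts G -> X = [set x; y; z] ->
  [set x; y] \in hedges_cap G X -> [set y; z] \in hedges_cap G X ->
  identified (oreconnect G X)
    (ograph (oreconnect G X) (sat_pairs (reconnect G X))).
Proof.
move=> sXV eX; rewrite -!sat_reconnect => Sxy Syz; split=> //=.
by rewrite -(sat_pairs_graph _ Sxy Syz) //= (setIidPr sXV).
Qed.

End Triples.

Lemma contextual_graph_associahedra_contextual :
  contextual_family contextual_graph_associahedra.
Proof.
have graphicalP (T : finType) (G : ohypergraph T) :
    contextual_graph_associahedra G <-> contextual G /\ graphical G.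
  split=> -[cG gG]; split=> // Z GZ; first by case: (gG Z GZ) => ->.
  have := gG Z GZ; have : 0 < #|Z| by rewrite card_gt0 (hedge_neq0 GZ).
  by case: #|Z| => [|[|[|]]] //; [left | right].
apply: contextual_familyP => T G; first by case.
  move=> C [cG gG] SC; apply: member_self; split.
    exact: contextual_restrict.
  by move=> Z; rewrite inE => /andP[GZ _]; apply: gG.
move=> X /graphicalP[cG gG] sX X3.
have SV : verts G \in Sat G by rewrite -connected_sat; case: cG.
have [x [y [z [_ eX Sxy Syz]]]] := reconnect3_path gG SV sX X3.
have eK := identified_sat_pairs sX eX Sxy Syz.
exists (ograph (oreconnect G X) (sat_pairs (reconnect G X))); last exact: eK.
apply/graphicalP; split; last exact: graph_graphical.
case: eK => eV _ eS; apply: contextual_card3; last by rewrite -eV /= (setIidPr sX).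
rewrite connected_sat -eS -eV -connected_sat; apply: reconnect_connected => //.
by rewrite (setIidPr sX) -card_gt0 X3.
Qed.

(** * Permutahedra *)

Section Permutahedra.
Variables (T : finType) (G : ohypergraph T).
Implicit Types C X : {set T}.
Hypothesis permG : permutahedra G.

Lemma sat_permutahedron :
  Sat G = [set X : {set T} | (X \subset verts G) && (X != set0)].
Proof.
have [_ eG] := permG; have gG := graph_graphical eG.
apply/setP=> X; rewrite [RHS]inE; apply/(graphical_satP _ gG)/andP.
  by case.
case=> sXV X0; split=> // A /andP[sAX /subsetPn[y Xy nAy]] /set0Pn[x Ax].
exists x, y; rewrite inE nAy; split=> //; rewrite eG; apply/graph_hedgesP.
right; exists x, y; rewrite !(subsetP sXV) ?(subsetP sAX x Ax) //=; split=> //.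
by apply: contraNneq nAy => <-.
Qed.

Lemma permutahedron_contextual : contextual G.
Proof.
have [V0 _] := permG; apply: contextual_meets; rewrite sat_permutahedron.
  by rewrite inE subxx.
move=> A B; rewrite !inE => /andP[sAV _] _ ->.
by rewrite andbT (subset_trans (subsetIl _ _)).
Qed.

Lemma permutahedron_restrict C : C \in Sat G -> permutahedra (orestrict G C).
Proof.
move=> SC; have [_ eG] := permG.
split; rewrite /= (setIidPr (sat_sub SC)) ?(sat_neq0 SC) //.
exact: graph_hedges_in eG (sat_sub SC).
Qed.

End Permutahedra.

Lemma permutahedra_contextual : contextual_family permutahedra.
Proof.
apply: contextual_familyP => T G; first exact: permutahedron_contextual.
  by move=> C pG SC; apply/member_self/permutahedron_restrict.
move=> X pG sX X3; pose K := ograph (oreconnect G X) [rel x y | x != y].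
have pK : permutahedra K.
  by split; rewrite //= (setIidPr sX) -card_gt0 X3.
exists K; first exact: pK.
split=> //; rewrite (sat_permutahedron pK) sat_reconnect.
apply/setP=> B; rewrite [RHS]inE /= (setIidPr sX); apply/hedges_capP/andP.
  by case=> Z [_ -> ->]; rewrite subsetIr.
case=> sB B0; exists B; rewrite (setIidPl sB) sat_permutahedron // inE B0.
by rewrite (subset_trans sB).
Qed.

(** * Associahedra *)

Section Associahedra.
Variables (T : finType) (G : ohypergraph T).
Implicit Types (x y z : T) (A B C X : {set T}).

Definition interval X := [/\ X \subset verts G, X != set0 &
  forall a b c, a \in X -> c \in X -> b \in verts G ->
    ole G a b -> ole G b c -> b \in X].

(** Among the pairs a <= c of X separated by A, one with the fewest vertices in
    between is consecutive: a vertex strictly between them lies in X, and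
    together with a or with c it would form a closer separated pair. *)
Lemma interval_change A X : interval X -> A \proper X -> A != set0 ->
  exists a c, [/\ a \in X, c \in X, (a \in A) != (c \in A) & consecutive G a c].
Proof.
case=> /subsetP sXV _ ivX /andP[/subsetP sAX /subsetPn[v Xv nAv]] /set0Pn[u Au].
have Xu := sAX u Au.
pose P := [pred p : T * T | [&& p.1 \in X, p.2 \in X, ole G p.1 p.2
                             & (p.1 \in A) != (p.2 \in A)]].
have [p0 Pp0] : exists p, P p.
  case/orP: (ole_or (sXV u Xu) (sXV v Xv)) => uv.
    by exists (u, v); rewrite /= Xu Xv uv Au (negPf nAv).
  by exists (v, u); rewrite /= Xu Xv uv Au (negPf nAv).
pose F (p : T * T) := #|[set w in verts G | ole G p.1 w && ole G w p.2]|.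
case: (@arg_minnP _ p0 P F Pp0) => -[a c] /and4P[/= Xa Xc ac nAac] minac.
have [Va Vc] := (sXV a Xa, sXV c Xc).
exists a, c; split=> //; apply/andP; split.
  by rewrite /olt /= ac andbT; apply: contraNneq nAac => ->.
apply/exists_inP=> -[b Vb /andP[/andP[nab ab] /andP[nbc bc]]].
have Xb : b \in X by apply: ivX ab bc.
have shorter p : P p -> {subset [set w in verts G | ole G p.1 w && ole G w p.2]
    <= [set w in verts G | ole G a w && ole G w c]} ->
    forall t, t \in verts G -> ole G a t -> ole G t c ->
      ~~ (ole G p.1 t && ole G t p.2) -> False.
  move=> Pp /subsetP sp t Vt at_ tc ntp; have := minac p Pp; rewrite leqNgt.
  case/negP; apply: proper_card; rewrite properE sp; apply/subsetPn; exists t.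
    by rewrite inE Vt at_ tc.
  by rewrite inE Vt.
have [eAb|nAb] := eqVneq (b \in A) (a \in A).
  apply: (shorter (b, c) _ _ a Va (ole_refl Va) ac).
  - by rewrite /= Xb Xc bc eAb.
  - move=> w; rewrite !inE /= => /and3P[Vw bw ->]; rewrite Vw andbT /=.
    exact: ole_trans ab bw.
  by rewrite /= ac andbT; apply: contra nab => ba; rewrite (ole_anti Va Vb ab ba).
apply: (shorter (a, b) _ _ c Vc ac (ole_refl Vc)).
- by rewrite /= Xb Xa ab eq_sym.
- move=> w; rewrite !inE /= => /and3P[Vw -> wb]; rewrite Vw /=.
  exact: ole_trans wb bc.
by rewrite /= ac; apply: contra nbc => cb; rewrite (ole_anti Vb Vc bc cb).
Qed.

Hypothesis assocG : associahedra G.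

(** An interval is connected by the preceding lemma. Conversely, if b lies
    between two elements of X but not in X, no consecutive pair crosses the
    part of X below b. *)
Lemma sat_associahedron X : X \in Sat G <-> interval X.
Proof.
have [_ eG] := assocG; have gG := graph_graphical eG; split.
  case/(graphical_satP _ gG)=> sXV X0 cX; have sXV' := subsetP sXV.
  split=> // a b c Xa Xc Vb ab bc; apply: contraT => nXb.
  have [|| x [y [/setIdP[Xx xb] /setDP[Xy nAy]]]] := cX [set w in X | ole G w b].
  - rewrite properE; apply/andP; split.
      by apply/subsetP=> w; rewrite inE => /andP[].
    apply/subsetPn; exists c; rewrite ?inE ?Xc //=.
    apply: contraNN nXb => cb; suff -> : b = c by [].
    exact: ole_anti Vb (sXV' c Xc) bc cb.
  - by apply/set0Pn; exists a; rewrite inE Xa.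
  have Vx := sXV' x Xx; have Vy := sXV' y Xy.
  have nyb : ~~ ole G y b by move: nAy; rewrite inE Xy.
  have byb : ole G b y by case/orP: (ole_or Vb Vy) => // yb; rewrite yb in nyb.
  have nxy : x != y by apply: contraNneq nyb => <-.
  rewrite (graph_edge eG) // => /orP[]/andP[/andP[_ xy]].
    move/exists_inPn/(_ b Vb)/negP; case; rewrite /olt /= xb byb !andbT.
    by apply/andP; split; apply: contraNneq nXb => e; [rewrite -e | rewrite e].
  by case/negP: nyb; apply: ole_trans xy xb.
move=> ivX; have [sXV X0 _] := ivX; apply/(graphical_satP _ gG); split=> // A pA A0.
have [a [c [Xa Xc nAac ac]]] := interval_change ivX pA A0.
have Eac : [set a; c] \in hedges G.
  rewrite eG; apply/graph_hedgesP; right; exists a, c.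
  by rewrite !(subsetP sXV).
have [Aa|nAa] := boolP (a \in A).
  by exists a, c; rewrite inE Xc andbT; move: nAac; rewrite Aa; case: (c \in A).
exists c, a; rewrite inE Xa nAa setUC; split=> //.
by move: nAac; rewrite (negPf nAa); case: (c \in A).
Qed.

Lemma associahedron_contextual : contextual G.
Proof.
have [V0 _] := assocG; apply: contextual_meets; first exact/sat_associahedron.
move=> A B /sat_associahedron[sAV _ ivA] /sat_associahedron[_ _ ivB] AB.
apply/sat_associahedron; split=> //; first exact: subset_trans (subsetIl _ _) sAV.
move=> a b c /setIP[Aa Ba] /setIP[Ac Bc] Vb ab bc.
by rewrite inE (ivA a b c) // (ivB a b c).
Qed.

Lemma associahedron_restrict C : C \in Sat G -> associahedra (orestrict G C).
Proof.
move=> SC; have [_ eG] := assocG; have /sat_associahedron[sCV C0 ivC] := SC.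
split; rewrite /= (setIidPr sCV) //.
rewrite -[LHS]/(hedges_in G C) (graph_hedges_in eG) //.
apply: graph_hedges_eq => x y Cx Cy _; rewrite /consecutive; congr (_ && ~~ _).
apply/exists_inP/exists_inP=> -[z]; last by rewrite inE => /andP[Vz _]; exists z.
move=> Vz /andP[/andP[nxz xz] /andP[nzy zy]]; exists z.
  by rewrite inE Vz (ivC x z y).
by rewrite /olt /= nxz xz nzy.
Qed.

End Associahedra.

(** An interval B of X is the trace of its convex hull Z among all vertices, so
    the reconnected restriction has the intervals of X as connected sets. *)
Lemma associahedra_contextual : contextual_family associahedra.
Proof.
apply: contextual_familyP => T G; first exact: associahedron_contextual.
  by move=> C aG SC; apply/member_self/associahedron_restrict.
move=> X aG sX X3.
pose K := ograph (oreconnect G X) (consecutive (oreconnect G X)).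
have aK : associahedra K.
  by split; rewrite //= (setIidPr sX) -card_gt0 X3.
have sX' := subsetP sX.
exists K; first exact: aK.
split=> //; rewrite sat_reconnect; apply/setP=> B; apply/hedges_capP/idP.
  case=> Z [/(sat_associahedron aG)[sZV _ ivZ] -> B0].
  apply/(sat_associahedron aK); split=> //=; first exact: setSI.
  move=> a b c /setIP[Za Xa] /setIP[Zc Xc] /setIP[Vb Xb] ab bc.
  by rewrite inE Xb (ivZ a b c).
case/(sat_associahedron aK)=> /=; rewrite (setIidPr sX) => /subsetP sBX B0 ivB.
pose Z := [set v in verts G | 
  [exists a in B, ole G a v] && [exists c in B, ole G v c]].
have sBZ : B \subset Z.
  apply/subsetP=> b Bb; have Vb := sX' b (sBX b Bb); rewrite inE Vb /=.
  by apply/andP; split; apply/exists_inP; exists b; rewrite ?ole_refl.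
have eB : B = Z :&: X.
  apply/eqP; rewrite eqEsubset subsetI sBZ; apply/andP; split.
    exact/subsetP.
  apply/subsetP=> b; rewrite !inE => /andP[/and3P[Vb]].
  by case/exists_inP=> a Ba ab /exists_inP[c Bc bc] Xb; apply: (ivB a b c).
exists Z; split=> //; apply/(sat_associahedron aG); split.
- by apply/subsetP=> v; rewrite inE => /andP[].
- by case/set0Pn: B0 => b /(subsetP sBZ) Zb; apply/set0Pn; exists b.
move=> a b c; rewrite !inE => /and3P[Va /exists_inP[u Bu ua] _].
case/and3P=> Vc _ /exists_inP[w Bw cw] Vb ab bc; rewrite Vb /=.
have [Vu Vw] := (sX' u (sBX u Bu), sX' w (sBX w Bw)).
apply/andP; split; apply/exists_inP; [exists u | exists w] => //.
  exact: ole_trans ua ab.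
exact: ole_trans bc cw.
Qed.

(** * Endpoints of edge sets *)

Section Spans.
Variables (T W : finType) (G : hypergraph T) (f : T -> {set W}).
Implicit Types (A B C D X : {set T}) (x y : T).

(** When the elements of T label the edges of a graph on W, this is the set of
    endpoints of the edges in A. *)
Definition span A : {set W} := \bigcup_(x in A) f x.

Lemma spanU A B : span (A :|: B) = span A :|: span B.
Proof. exact: bigcup_setU. Qed.

Lemma spanS A B : A \subset B -> span A \subset span B.
Proof. by move=> /setUidPr<-; rewrite spanU subsetUl. Qed.

Lemma sub_span A x : x \in A -> f x \subset span A.
Proof. exact: bigcup_sup. Qed.

Definition intersecting : rel T := [rel x y | (x != y) && (f x :&: f y != set0)].

Hypothesis eG : hedges G = graph_hedges (verts G) intersecting.

Lemma intersecting_satP X :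
  reflect [/\ X \subset verts G, X != set0 &
           forall A, A \proper X -> A != set0 ->
             exists x y, [/\ x \in A, y \in X :\: A & f x :&: f y != set0]]
          (X \in Sat G).
Proof.
apply: (iffP (graphical_satP _ (graph_graphical eG))) => -[sXV X0 cX].
all: split=> // A pA A0; have [x [y [Ax XAy xy]]] := cX A pA A0.
all: have [Xy nAy] := setDP XAy; exists x, y; split=> //.
all: have nxy : x != y by apply: contraNneq nAy => <-.
all: have Vx : x \in verts G by rewrite (subsetP sXV) ?(subsetP (proper_sub pA)).
all: have Vy : y \in verts G by rewrite (subsetP sXV).
  move: xy; rewrite (graph_edge eG) // /intersecting /= (setIC (f y)) (eq_sym y).
  by rewrite orbb => /andP[].
by rewrite (graph_edge eG) // /intersecting /= nxy xy.
Qed.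

Hypothesis f2 : forall x, x \in verts G -> #|f x| = 2.

(** While A is not all of the connected set B, some edge of B outside A has an
    endpoint in common with an edge of A; adding it to A brings at most one new
    endpoint. *)
Lemma span_grow A B : B \in Sat G -> A \subset B -> A != set0 ->
  #|span B| + #|A| <= #|span A| + #|B|.
Proof.
move=> SB; have [n le_n] := ubnP #|B :\: A|; elim: n A le_n => // n IH A.
rewrite ltnS => le_n sAB A0; have [-> //|nAB] := eqVneq A B.
have [_ _ cB] := intersecting_satP _ SB.
have [|x [y [Ax /setDP[By nAy] xy]]] := cB A _ A0.
  by rewrite properEneq nAB.
have := IH (y |: A); rewrite cardsU1 nAy.
have -> : #|span (y |: A)| = #|f y :|: span A|.
  by rewrite spanU /span big_set1.
rewrite subUset sub1set By sAB setU_eq0 negb_and A0 orbT.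
have : 0 < #|f y :&: span A|.
  apply: leq_trans (subset_leq_card (setIS _ (sub_span Ax))).
  by rewrite setIC card_gt0.
have := cardsUI (f y) (span A); rewrite f2 ?(subsetP (sat_sub SB)) // => cU cI.
have : #|B :\: (y |: A)| < n.
  apply: leq_trans le_n; apply: proper_card; rewrite properE setDS ?subsetUr //=.
  by apply/subsetPn; exists y; rewrite !inE ?nAy ?By ?eqxx.
by move=> lt_n /(_ lt_n isT isT); lia.
Qed.

Hypotheses (SV : verts G \in Sat G) (cV : #|span (verts G)| = #|verts G|.+1).

(** The whole graph has exactly one more vertex than edges; growing A to the
    whole edge set shows that A has at least as large an excess, and the next
    lemma gives equality on connected sets. *)
Lemma card_span_gt A : A \subset verts G -> A != set0 -> #|A| < #|span A|.
Proof. by move=> sAV A0; have := span_grow SV sAV A0; rewrite cV; lia. Qed.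

Lemma card_span_sat B : B \in Sat G -> #|span B| = #|B|.+1.
Proof.
move=> SB; have sBV := sat_sub SB; apply/eqP.
rewrite eqn_leq card_span_gt ?(sat_neq0 SB) // andbT.
have /set0Pn[x Bx] := sat_neq0 SB.
have := @span_grow [set x] B SB; rewrite sub1set Bx set1_neq0 cards1.
have -> : span [set x] = f x by rewrite /span big_set1.
by rewrite f2 ?(subsetP sBV) // => /(_ isT isT); lia.
Qed.

(** Counting replaces an argument on paths in a tree. For connected A and B that
    meet, inclusion and exclusion leaves #|A :&: B| + 1 endpoints common to the
    edges of A and to those of B. If A :&: B fell apart into two non-adjacent
    non-empty parts, the disjoint sets of their endpoints would have at least
    #|A :&: B| + 2 elements in all. *)
Lemma intersecting_meets : meets (Sat G).
Proof.
move=> A B SA SB AB0; apply/intersecting_satP; split=> //.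
  exact: subset_trans (subsetIl _ _) (sat_sub SA).
move=> D /andP[sD nsD] D0.
have [/exists_inP[x Dx /exists_inP[y Ey xy]]|noedge] :=
  boolP [exists x in D, exists y in (A :&: B) :\: D, f x :&: f y != set0].
  by exists x, y.
have sIV : A :&: B \subset verts G := subset_trans (subsetIl _ _) (sat_sub SA).
have gD := card_span_gt (subset_trans sD sIV) D0.
have gE : #|(A :&: B) :\: D| < #|span ((A :&: B) :\: D)|.
  by rewrite card_span_gt ?setD_eq0 // (subset_trans (subsetDl _ _)).
have dDE : span D :&: span ((A :&: B) :\: D) = set0.
  apply: contraNeq noedge => /set0Pn[w /setIP[/bigcupP[x Dx xw] /bigcupP[y Ey yw]]].
  apply/exists_inP; exists x => //; apply/exists_inP; exists y => //.
  by apply/set0Pn; exists w; rewrite inE xw.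
have cDE := cardsUI (span D) (span ((A :&: B) :\: D)).
rewrite dDE cards0 addn0 -spanU setDE setUIr setUCr setIT (setUidPr sD) in cDE.
have cI := cardsID D (A :&: B); rewrite (setIidPr sD) in cI.
have sI : #|span (A :&: B)| <= #|span A :&: span B|.
  by rewrite subset_leq_card // subsetI !spanS ?subsetIl ?subsetIr.
have cU := cardsUI (span A) (span B); rewrite -spanU in cU.
have cUI := cardsUI A B.
rewrite !card_span_sat ?sat_joins // in cU.
by rewrite -setDE in cDE; lia.
Qed.

End Spans.

(** * Operahedra *)

Section Trees.
Variables (W : finType) (e : rel W).
Hypothesis treeW : is_tree e.
Implicit Types (u v w : W) (K Z : {set W}).

(** Pairs u, u are excluded by irreflexivity, so an edge remembers the relation
    that it comes from. *)
Lemma tree_edge u v : ([set u; v] \in tree_edges e) = e u v.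
Proof.
case: treeW => _ sym irr _ _; apply/imsetP/idP => [[[a b]]|euv]; last first.
  by exists (u, v); rewrite ?inE.
rewrite inE /= => eab eq_uv.
have nuv : u != v.
  apply: contraTneq eab => uv; have := cards1 v; rewrite -(setUid [set v]).
  rewrite -{1}uv eq_uv cards2; case: eqP => // -> _; by rewrite irr.
have: u \in [set a; b] by rewrite -eq_uv set21.
have: v \in [set a; b] by rewrite -eq_uv set22.
case/set2P=> ev /set2P[] eu; rewrite eu ev in nuv *; rewrite ?eqxx // in nuv.
by rewrite sym.
Qed.

Lemma card_tree_edge Z : Z \in tree_edges e -> #|Z| = 2.
Proof.
case: treeW => _ _ irr _ _ /imsetP[[a b]]; rewrite inE /= => eab ->.
by rewrite cards2; case: eqP eab => // ->; rewrite irr.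
Qed.

Lemma tree_closed K : K != set0 ->
  (forall u v, e u v -> u \in K -> v \in K) -> K = setT.
Proof.
case: treeW => _ sym _ conn _ /set0Pn[u Ku] cK.
apply/setP=> v; rewrite inE.
by rewrite -(closed_connect (intro_closed (sym_connect_sym sym) cK) (conn u v)).
Qed.

End Trees.

Section Operahedra.
Variables (T W : finType) (e : rel W) (G : hypergraph T) (f : T -> {set W}).
Implicit Types (A C : {set T}) (x y : T).
Hypotheses (treeW : is_tree e) (V0 : verts G != set0).
Hypothesis imf : f @: verts G = tree_edges e.
Hypothesis eG : hedges G = graph_hedges (verts G) (intersecting f).

Lemma card_label x : x \in verts G -> #|f x| = 2.
Proof. by move=> Vx; apply: (card_tree_edge treeW); rewrite -imf imset_f. Qed.

Lemma edge_label u v : e u v -> exists2 x, x \in verts G & f x = [set u; v].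
Proof.
by rewrite -(tree_edge treeW) -imf => /imsetP[x Vx ->]; exists x.
Qed.

Lemma span_neq0 A : A \subset verts G -> A != set0 -> span f A != set0.
Proof.
move=> sAV /set0Pn[a Aa]; rewrite -card_gt0.
apply: leq_trans (subset_leq_card (sub_span f Aa)).
by rewrite card_label ?(subsetP sAV).
Qed.

Lemma span_verts : span f (verts G) = setT.
Proof.
apply: (tree_closed treeW); first exact: span_neq0.
move=> u v /edge_label[x Vx fx] _; apply/bigcupP; exists x => //.
by rewrite fx set22.
Qed.

(** If no edge of A had an endpoint in common with an edge outside A, the set of
    endpoints of A would be closed under adjacency, hence would be all of the
    tree. *)
Lemma line_graph_connected : verts G \in Sat G.
Proof.
apply/(intersecting_satP eG); split=> // A /andP[sAV nsVA] A0.
have [/exists_inP[x Ax /exists_inP[y Ay xy]]|noedge] :=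
  boolP [exists x in A, exists y in verts G :\: A, f x :&: f y != set0].
  by exists x, y.
have AE x y w : x \in A -> y \in verts G -> w \in f x -> w \in f y -> y \in A.
  move=> Ax Vy xw yw; apply: contraNT noedge => nAy.
  apply/exists_inP; exists x => //; apply/exists_inP; exists y; rewrite ?inE ?nAy //.
  by apply/set0Pn; exists w; rewrite inE xw.
have /setP spanA : span f A = setT.
  apply: (tree_closed treeW); first exact: span_neq0.
  move=> u v /edge_label[y Vy fy] /bigcupP[x Ax xu]; apply/bigcupP.
  by exists y; rewrite ?(AE x y u) // fy ?set21 ?set22.
have /subsetPn[y Vy nAy] := nsVA.
have /set0Pn[w yw] : f y != set0 by rewrite -card_gt0 card_label.
have := spanA w; rewrite in_setT => /bigcupP[x Ax xw].
by rewrite (AE x y w) in nAy.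
Qed.

Hypothesis cardW : #|W| = #|verts G|.+1.

Lemma card_span_verts : #|span f (verts G)| = #|verts G|.+1.
Proof. by rewrite span_verts cardsT. Qed.

Lemma line_graph_meets : meets (Sat G).
Proof.
exact: (intersecting_meets eG card_label line_graph_connected card_span_verts).
Qed.

Lemma card_span_connected C : C \in Sat G -> #|span f C| = #|C|.+1.
Proof.
exact: (card_span_sat eG card_label line_graph_connected card_span_verts).
Qed.

Section Subtree.
Variable C : {set T}.
Hypothesis SC : C \in Sat G.

(** A connected set C of edges spans a subtree, of which the restriction to C is
    the line graph. Adjacency in the subtree is defined from the edges
    labelled by C. *)
Definition subtree_vertex := {w : W | w \in span f C}.
Implicit Types u v w : subtree_vertex.

Definition subtree_rel : rel subtree_vertex :=
  [rel u v | [set val u; val v] \in f @: C].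

Definition subtree_label x : {set subtree_vertex} := [set w | val w \in f x].

Lemma val_subtree_label x : x \in C -> val @: subtree_label x = f x.
Proof.
move=> Cx; apply/setP=> w; apply/imsetP/idP => [[v]|xw].
  by rewrite inE => vx ->.
have Cw : w \in span f C by apply/bigcupP; exists x.
by exists (Sub w Cw); rewrite ?inE.
Qed.

Lemma subtree_rel_sub u v : subtree_rel u v -> e (val u) (val v).
Proof.
rewrite -(tree_edge treeW) -imf; apply: subsetP.
exact: imsetS (sat_sub SC).
Qed.

Lemma subtree_rel_sym : symmetric subtree_rel.
Proof. by move=> u v; rewrite /subtree_rel /= setUC. Qed.

Lemma subtree_rel_label u v x : x \in C -> u != v ->
  u \in subtree_label x -> v \in subtree_label x -> subtree_rel u v.
Proof.
rewrite !inE => Cx nuv xu xv; apply/imsetP; exists x => //.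
apply/eqP; rewrite eqEcard subUset !sub1set xu xv.
by rewrite card_label ?(subsetP (sat_sub SC)) // cards2 val_eqE nuv.
Qed.

(** The edges of C that have an endpoint reachable from u form a non-empty set
    which no intersecting pair of edges of C leaves; as C is connected, they are
    all of C. *)
Lemma subtree_connect u v : connect subtree_rel u v.
Proof.
have same x a b : x \in C -> a \in subtree_label x -> b \in subtree_label x ->
    connect subtree_rel a b.
  move=> Cx xa xb; have [->|nab] := eqVneq a b; first exact: connect0.
  exact/connect1/(subtree_rel_label Cx).
have label w : exists2 x, x \in C & w \in subtree_label x.
  by case/bigcupP: (valP w) => x Cx xw; exists x; rewrite ?inE.
pose A := [set x in C | [exists w in subtree_label x, connect subtree_rel u w]].
have sAC : A \subset C by apply/subsetP=> x /setIdP[].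
have A0 : A != set0.
  have [x Cx xu] := label u; apply/set0Pn; exists x; rewrite inE Cx.
  by apply/exists_inP; exists u.
suff eAC : A = C.
  have [x Cx xv] := label v; have : x \in A by rewrite eAC.
  case/setIdP=> _ /exists_inP[w xw uw].
  exact: connect_trans uw (same x w v Cx xw xv).
apply: contraTeq isT => nAC; have [_ _ cC] := intersecting_satP eG _ SC.
have [|x [y [Ax /setDP[Cy nAy] xy]]] := cC A _ A0.
  by rewrite properEneq nAC.
case/negP: nAy.
case/setIdP: Ax => Cx /exists_inP[w xw uw]; case/set0Pn: xy => t /setIP[xt yt].
have Ct : t \in span f C by apply/bigcupP; exists x.
rewrite inE Cy; apply/exists_inP; exists (Sub t Ct); rewrite ?inE //.
by apply: connect_trans uw (same x w _ Cx xw _); rewrite inE.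
Qed.

Lemma card_subtree_vertex : #|{: subtree_vertex}| = #|C|.+1.
Proof. by rewrite card_sig -card_span_connected //; apply: eq_card. Qed.

Lemma subtree_is_tree : is_tree subtree_rel.
Proof.
have [_ _ irr _ acy] := treeW; split.
- by rewrite card_subtree_vertex.
- exact: subtree_rel_sym.
- by move=> u; apply: contraFF (irr (val u)) => /subtree_rel_sub.
- exact: subtree_connect.
move=> c /andP[cyc_c uniq_c]; rewrite -(size_map val); apply: acy.
rewrite /ucycle map_inj_uniq ?uniq_c ?andbT; last exact: val_inj.
case: c cyc_c {uniq_c} => //= u c; rewrite -map_rcons path_map.
by apply: sub_path => ? ?; apply: subtree_rel_sub.
Qed.

Lemma subtree_label_inj : {in verts G &, injective f} ->
  {in C &, injective subtree_label}.
Proof.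
move=> injf x y Cx Cy fxy; apply: injf; rewrite ?(subsetP (sat_sub SC)) //.
by rewrite -(val_subtree_label Cx) fxy val_subtree_label.
Qed.

Lemma subtree_label_edges : subtree_label @: C = tree_edges subtree_rel.
Proof.
apply/setP=> Z; apply/imsetP/imsetP => [[x Cx ->]|[[u v]]].
  have /eqP/cards2P[u [v [nuv eZ]]] : #|subtree_label x| = 2.
    rewrite -(card_imset _ val_inj) val_subtree_label // card_label //.
    by apply: subsetP Cx; apply: sat_sub.
  exists (u, v); rewrite // inE /=; apply: (subtree_rel_label Cx nuv).
    by rewrite eZ set21.
  by rewrite eZ set22.
rewrite inE => /imsetP[x Cx fx] ->; exists x => //.
by apply/setP=> w; rewrite !inE -fx !inE.
Qed.

Lemma subtree_intersecting :
  {in C &, intersecting subtree_label =2 intersecting f}.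
Proof.
move=> x y Cx Cy; congr (_ && _); apply/set0Pn/set0Pn => -[w].
  by rewrite !inE => xyw; exists (val w); rewrite inE.
case/setIP=> xw yw; have Cw : w \in span f C by apply/bigcupP; exists x.
by exists (Sub w Cw); rewrite !inE xw.
Qed.

End Subtree.
End Operahedra.

(** Rooted trees on 'I_n.+1 are given by a parent function that decreases
    indices, the root being 0. *)
Section ParentTrees.
Variables (n : nat) (p : 'I_n.+1 -> 'I_n.+1).
Hypothesis ltp : forall i, i != ord0 -> p i < i.
Implicit Types i j m : 'I_n.+1.

Definition parent_rel : rel 'I_n.+1 :=
  [rel i j | (i != ord0) && (p i == j) || (j != ord0) && (p j == i)].

Definition parent_edge i : {set 'I_n.+1} := [set i; p i].

Lemma parent_rel_sym : symmetric parent_rel.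
Proof. by move=> i j; rewrite /parent_rel /= orbC. Qed.

Lemma parent_rel_neighbour i j : parent_rel i j -> j <= i -> p i = j.
Proof.
case/orP=> /andP[i0 /eqP e] le_ji; first by [].
by have := ltp i0; rewrite e ltnNge le_ji.
Qed.

Lemma parent_rel_irr : irreflexive parent_rel.
Proof.
move=> i; rewrite /parent_rel /= orbb; apply/negP=> /andP[i0 /eqP e].
by have := ltp i0; rewrite e ltnn.
Qed.

Lemma parent_rel_connect i j : connect parent_rel i j.
Proof.
suff root k : connect parent_rel ord0 k.
  apply: connect_trans (root j); rewrite (sym_connect_sym parent_rel_sym).
  exact: root.
have [m le_m] := ubnP (k : nat); elim: m k le_m => // m IH k le_m.
have [->|k0] := eqVneq k ord0; first exact: connect0.
apply: (@connect_trans _ _ (p k)); first by apply: IH; have := ltp k0; lia.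
by apply: connect1; rewrite /parent_rel /= k0 eqxx orbT.
Qed.

(** In a cycle, both neighbours of the vertex of largest index are its parent;
    hence they are equal and the cycle has at most two vertices. *)
Lemma parent_rel_acyclic (c : seq 'I_n.+1) : ucycle parent_rel c -> size c < 3.
Proof.
case: c => // i0 c0; set c := i0 :: c0 => cyc_c; rewrite ltnNge; apply/negP=> c3.
have ci0 : i0 \in c by rewrite mem_head.
case: (@arg_maxnP _ i0 [in c] (@nat_of_ord _) ci0) => m cm maxm.
have [k s rs] := rot_to cm; move: cyc_c c3.
rewrite -(rot_ucycle k) -(size_rot k) rs.
have {}maxm j : j \in s -> j <= m.
  move=> sj; have cj : j \in c by rewrite -(mem_rot k) rs inE sj orbT.
  exact: maxm.
case: s maxm {rs} => [|a [|b s]] //= maxm /andP[/=].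
rewrite rcons_path => /and4P[ma _ _ lm] /and3P[_ nab _] _.
have am : a <= m by apply: maxm; rewrite mem_head.
have ls : last b s \in b :: s by apply: mem_last.
have lem : last b s <= m by apply: maxm; rewrite inE ls orbT.
rewrite parent_rel_sym in lm.
by move: nab; rewrite -(parent_rel_neighbour ma am) (parent_rel_neighbour lm lem) ls.
Qed.

Lemma parent_tree : is_tree parent_rel.
Proof.
split; first by rewrite card_ord.
- exact: parent_rel_sym.
- exact: parent_rel_irr.
- exact: parent_rel_connect.
exact: parent_rel_acyclic.
Qed.

Lemma parent_tree_edges :
  tree_edges parent_rel = [set parent_edge i | i in ~: [set ord0]].
Proof.
apply/setP=> Z; apply/imsetP/imsetP => [[[i j]]|[i]]; rewrite !inE.
  case/orP=> /= /andP[k0 /eqP <-] ->; [exists i | exists j] => //=; rewrite ?inE //.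
  exact: setUC.
by move=> i0 ->; exists (i, p i); rewrite // inE /= /parent_rel /= i0 eqxx.
Qed.

Lemma parent_edge_inj : {in ~: [set ord0] &, injective parent_edge}.
Proof.
move=> i j; rewrite !inE => i0 j0 eij.
have: i \in parent_edge j by rewrite -eij set21.
have: j \in parent_edge i by rewrite eij set21.
case/set2P=> // ji /set2P[] // ij.
by have := ltp i0; have := ltp j0; rewrite -ji -ij; lia.
Qed.

End ParentTrees.

(** The connected graphs on x, y, z in which y is adjacent to both other
    vertices are line graphs of trees with vertices 0, 1, 2, 3. The edges from 1
    and 2 to the root 0 carry the labels y and x. The edge labelled z joins 3 to
    the root when x and z are adjacent, that is, when b holds, and otherwise to
    1, an endpoint of the edge labelled y but not of the one labelled x. *)
Section FourVertexTrees.
Variables (T : finType) (x y z : T).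
Hypothesis Uxyz : uniq [:: x; y; z].
Variable b : bool.

Let i1 : 'I_4 := @Ordinal 4 1 isT.
Let i2 : 'I_4 := @Ordinal 4 2 isT.
Let i3 : 'I_4 := @Ordinal 4 3 isT.

Definition star_or_path_parent (i : 'I_4) : 'I_4 :=
  if (i == i3) && ~~ b then i1 else ord0.

Definition star_or_path_number (t : T) : 'I_4 :=
  if t == y then i1 else if t == x then i2 else i3.

Definition star_or_path_label (t : T) : {set 'I_4} :=
  parent_edge star_or_path_parent (star_or_path_number t).

Lemma star_or_path_parent_lt i : i != ord0 -> star_or_path_parent i < i.
Proof. by rewrite /star_or_path_parent; case: i => [[|[|[|[|]]]]] //=; case: b. Qed.

Lemma star_or_path_tree : is_tree (parent_rel star_or_path_parent).
Proof. exact: (parent_tree star_or_path_parent_lt). Qed.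

Let numbers : (star_or_path_number x = i2) * (star_or_path_number y = i1) *
  (star_or_path_number z = i3).
Proof.
move: Uxyz; rewrite /star_or_path_number /= !inE negb_or andbT eqxx.
case/andP=> /andP[nxy nxz] nyz; rewrite (negPf nxy) (eq_sym z y) (negPf nyz).
by rewrite (eq_sym z x) (negPf nxz) eqxx.
Qed.

Lemma star_or_path_number_neq0 t : star_or_path_number t \in ~: [set ord0].
Proof. by rewrite /star_or_path_number !inE; case: ifP => // _; case: ifP. Qed.

Lemma star_or_path_label_inj :
  {in [set x; y; z] &, injective star_or_path_label}.
Proof.
move=> t u Xt Xu /(parent_edge_inj star_or_path_parent_lt) e.
have {}e := e (star_or_path_number_neq0 t) (star_or_path_number_neq0 u).
move: Xt Xu e; rewrite !inE -!orbA => /or3P[]/eqP-> /or3P[]/eqP->;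
  by rewrite !numbers.
Qed.

Lemma star_or_path_label_edges : star_or_path_label @: [set x; y; z] =
  tree_edges (parent_rel star_or_path_parent).
Proof.
rewrite parent_tree_edges; apply/setP=> Z; apply/imsetP/imsetP => [[t Xt ->]|].
  exists (star_or_path_number t) => //; exact: star_or_path_number_neq0.
case=> i; rewrite !inE => i0 ->.
have [t Xt <-] : exists2 t, t \in [set x; y; z] & star_or_path_number t = i.
  case: i i0 => [[|[|[|[|]]]]] //= lti _; [exists y | exists x | exists z];
    rewrite ?inE ?eqxx ?orbT // numbers; exact: val_inj.
by exists t.
Qed.

Lemma star_or_path_intersecting :
  [/\ intersecting star_or_path_label x y, intersecting star_or_path_label y z
    & intersecting star_or_path_label x z = b].
Proof.
move: Uxyz; rewrite /= !inE negb_or andbT => /andP[/andP[nxy nxz] nyz].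
rewrite /intersecting /= nxy nxz nyz /star_or_path_label !numbers /parent_edge.
rewrite /star_or_path_parent /=; split.
- by apply/set0Pn; exists ord0; rewrite !inE.
- by apply/set0Pn; case: b; [exists ord0 | exists i1]; rewrite !inE.
case: b => /=; first by apply/set0Pn; exists ord0; rewrite !inE.
apply/negbTE; rewrite negbK; apply/eqP/setP=> i; rewrite !inE.
by case: i => [[|[|[|[|]]]]].
Qed.

End FourVertexTrees.

Lemma intersecting_sym (T W : finType) (f : T -> {set W}) :
  symmetric (intersecting f).
Proof. by move=> x y; rewrite /intersecting /= eq_sym setIC. Qed.

Lemma operahedra_contextual : contextual_family operahedra.
Proof.
apply: contextual_familyP => T G.
- case=> V0 [W [e [f [treeW cW _ imf eG]]]].
  apply: contextual_meets; first exact: line_graph_connected treeW V0 imf eG.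
  exact: line_graph_meets treeW V0 imf eG cW.
- move=> C [V0 [W [e [f [treeW cW injf imf eG]]]]] SC; apply: member_self.
  have sCV := sat_sub SC; split; rewrite /= (setIidPr sCV) ?(sat_neq0 SC) //.
  exists {w : W | w \in span f C}, (@subtree_rel _ _ f C), (@subtree_label _ _ f C).
  split.
  + exact: subtree_is_tree treeW V0 imf eG cW _ SC.
  + exact: card_subtree_vertex treeW V0 imf eG cW _ SC.
  + exact: subtree_label_inj SC injf.
  + exact: subtree_label_edges treeW imf _ SC.
  rewrite -[LHS]/(hedges_in G C) (graph_hedges_in eG) //.
  apply: graph_hedges_eq => x y Cx Cy _.
  exact/esym/(subtree_intersecting f Cx Cy).
move=> X [V0 [W [e [f [treeW cW injf imf eG]]]]] sX X3.
have SV := line_graph_connected treeW V0 imf eG.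
have [x [y [z [Uxyz eX Sxy Syz]]]] := reconnect3_path (graph_graphical eG) SV sX X3.
exists (ograph (oreconnect G X) (sat_pairs (reconnect G X))); last first.
  exact: identified_sat_pairs sX eX Sxy Syz.
pose b := [set x; z] \in hedges_cap G X.
split; rewrite /= (setIidPr sX); first by rewrite -card_gt0 X3.
exists 'I_4, (parent_rel (star_or_path_parent b)), (star_or_path_label x y b).
split.
- exact: star_or_path_tree.
- by rewrite card_ord X3.
- by rewrite eX; apply: star_or_path_label_inj.
- by rewrite eX; apply: star_or_path_label_edges.
have [fxy fyz fxz] := star_or_path_intersecting Uxyz b.
apply: graph_hedges_eq => t u Xt Xu ntu.
rewrite /sat_pairs /= sat_reconnect.
rewrite -[RHS]/(intersecting (star_or_path_label x y b) t u).
move: Xt Xu ntu; rewrite [in X in t \in X]eX [in X in u \in X]eX !inE -!orbA.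
case/or3P=> /eqP-> /or3P[]/eqP->; rewrite ?eqxx // => _.
- by rewrite fxy.
- by rewrite setUC intersecting_sym fxy.
- by rewrite fyz.
- by rewrite setUC intersecting_sym fxz.
by rewrite setUC intersecting_sym fyz.
Qed.

Theorem theorem4p8 :
  contextual_family simplices /\
  contextual_family cubes /\
  contextual_family associahedra /\
  contextual_family permutahedra /\
  contextual_family operahedra /\
  contextual_family contextual_graph_associahedra /\
  contextual_family contextual_nestohedra.
Proof.
split; first exact: simplices_contextual.
split; first exact: cubes_contextual.
split; first exact: associahedra_contextual.
split; first exact: permutahedra_contextual.
split; first exact: operahedra_contextual.
split; first exact: contextual_graph_associahedra_contextual.
exact: contextual_nestohedra_contextual.
Qed.
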